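(* Let $$L(z)=\frac{K\,(z-1)^6(z-a)^3(z-b)}{z^5},\qquad K=\frac{11+5\sqrt5}{216},\quad a=\frac{-3+\sqrt5}{2},\quad b=\frac{7-3\sqrt5}{2},$$ and let $Q_0,Q_1,Q_2,Q_3,Q_4\in\mathbb{C}[z,z^{-1}]$ be the Laurent polynomials $$Q_0=1,\qquad Q_1=\frac{z^2+1}{z},\qquad Q_2=\frac{-(9+4\sqrt5)z^4+(20+8\sqrt5)z^3+1}{z^2},$$ $$Q_3=\frac{\left(\frac{47}{2}+\frac{21}{2}\sqrt5\right)z^6-\left(\frac{195}{2}+\frac{87}{2}\sqrt5\right)z^5+\left(\frac{255}{2}+\frac{111}{2}\sqrt5\right)z^4+1}{z^3},$$ $$Q_4=\frac{-(9+4\sqrt5)z^8+(130+58\sqrt5)z^7-(630+282\sqrt5)z^6+(910+406\sqrt5)z^5+1}{z^4}.$$ Then a Laurent polynomial $Q\in\mathbb{C}[z,z^{-1}]$ is orthogonal to all powers of $L$ on $S^1$, that is, satisfies $$\int_{S^1}L^i\,dQ=0\quad\text{for all integers } i\ge 0,$$ if and only if there exist polynomials $R_0,R_1,R_2,R_3,R_4\in\mathbb{C}[z]$ such that $$Q=\sum_{j=0}^4 (R_j\circ L)\cdot Q_j .$$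
   Context: $S^1$ is the unit circle in $\mathbb{C}$. For Laurent polynomials $L,Q$ with complex coefficients, $\int_{S^1}L^i\,dQ$ denotes the contour integral $\int_{S^1}L(z)^i\,Q'(z)\,dz$. The symbol $\circ$ denotes composition: $(R\circ L)(z)=R(L(z))$. *)

(* Defs.v *)
From HB Require Import structures.
From mathcomp Require Import all_boot all_order all_algebra.
From mathcomp Require Import generic_quotient.
From mathcomp Require Import complex ring.
From mathcomp Require Import all_classical all_reals all_analysis.

Set Implicit Arguments.
Unset Strict Implicit.
Unset Printing Implicit Defensive.

Import Order.TTheory GRing.Theory Num.Theory.
Local Open Scope ring_scope.

Local Notation "x %:F" := (tofrac x).

(* The ring F[z, 1/z] is taken inside the field {fraction {poly F}} of rational
   functions, so that equality of Laurent polynomials is Leibniz equality. *)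
Section RationalFunctions.
Variable F : fieldType.
Implicit Types (f g : {fraction {poly F}}) (p q : {poly F}) (z : F).

Definition laurent (p : {poly F}) (n : nat) : {fraction {poly F}} :=
  p%:F / ('X : {poly F})%:F ^+ n.

Definition is_laurent f : Prop :=
  exists (p : {poly F}) (n : nat), f = laurent p n.

(* repr f is an arbitrary fraction representing f; it is put in lowest terms so
   that ratval below only meets the genuine poles of f. *)
Definition ratnum f : {poly F} :=
  (repr f).1 %/ gcdp (repr f).1 (repr f).2.
Definition ratden f : {poly F} :=
  (repr f).2 %/ gcdp (repr f).1 (repr f).2.

Definition ratval f z : F := (ratnum f).[z] / (ratden f).[z].

Definition ratderiv f : {fraction {poly F}} :=
  ((ratnum f)^`() * ratden f - ratnum f * (ratden f)^`())%:F
    / (ratden f ^+ 2)%:F.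

Definition ratconst (c : F) : {fraction {poly F}} := (c%:P)%:F.
HB.instance Definition _ :=
  GRing.RMorphism.copy ratconst (@tofrac {poly F} \o @polyC F).

(* p \o f, i.e. the polynomial p evaluated at the element f of the F-algebra of
   rational functions; ratcompE relates it to composition of functions. *)
Definition ratcomp p f : {fraction {poly F}} := (map_poly ratconst p).[f].

Lemma ratden_neq0 f : ratden f != 0.
Proof.
rewrite /ratden; have d0 := denom_ratioP (repr f).
by rewrite dvdp_div_eq0 ?dvdp_gcdr.
Qed.

Lemma repr_frac f : f = ((repr f).1)%:F / ((repr f).2)%:F.
Proof.
have d0 := denom_ratioP (repr f).
apply: (mulIf (x := ((repr f).2)%:F)); first by rewrite tofrac_eq0.
rewrite divfK ?tofrac_eq0 // -{1}[f]reprK; case: (repr f) d0 => -[n d] /= H d0.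
rewrite -[tofrac d]/(FracField.tofrac d) -[tofrac n]/(FracField.tofrac n).
unlock FracField.tofrac; rewrite -[LHS]FracField.pi_mul.
apply/eqP; rewrite piE /FracField.equivf /= /FracField.mulf /=.
by rewrite !numden_Ratio ?mulr1 ?oner_neq0 ?mul1r // mulrC.
Qed.

Lemma ratnumden f : f = (ratnum f)%:F / (ratden f)%:F.
Proof.
rewrite {1}[f]repr_frac; have d0 := denom_ratioP (repr f).
set n := (repr f).1; set d := (repr f).2.
have g0 : gcdp n d != 0 by rewrite gcdp_eq0 negb_and d0 orbT.
rewrite -[in X in X / _](divpK (dvdp_gcdl n d)).
rewrite -[in X in _ / X = _](divpK (dvdp_gcdr n d)) !tofracM.
by rewrite -mulf_div divff ?mulr1 // tofrac_eq0.
Qed.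

Lemma ratnumden_cross p q : q != 0 ->
  ratnum (p%:F / q%:F) * q = p * ratden (p%:F / q%:F).
Proof.
move=> q0; set f := _ / _; have := ratnumden f.
rewrite {1}/f => /eqP; rewrite eqr_div ?tofrac_eq0 ?ratden_neq0 //.
by rewrite -!tofracM tofrac_eq => /eqP.
Qed.

Lemma coprime_ratnumden f : coprimep (ratnum f) (ratden f).
Proof.
rewrite /ratnum /ratden; apply: coprimep_div_gcd.
by rewrite (denom_ratioP (repr f)) orbT.
Qed.

Lemma ratval_frac p q z : q.[z] != 0 -> ratval (p%:F / q%:F) z = p.[z] / q.[z].
Proof.
move=> qz; have q0 : q != 0 by apply: contraNneq qz => ->; rewrite horner0.
rewrite /ratval; have := ratnumden_cross p q0.
have := coprime_ratnumden (p%:F / q%:F).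
set a := ratnum _; set b := ratden _ => cab e.
have bq : b %| q.
  by rewrite -(@Gauss_dvdpr _ q a b) 1?coprimep_sym // e dvdp_mulIr.
have bz : b.[z] != 0.
  apply: contraNneq qz => /eqP bz; move: bq => /(dvdp_trans _) bq.
  have : 'X - z%:P %| q by apply: bq; rewrite dvdp_XsubCl.
  by rewrite dvdp_XsubCl.
apply/eqP; rewrite eqr_div // -!hornerM e; exact: eqxx.
Qed.

Lemma ratderiv_frac p q : q != 0 ->
  ratderiv (p%:F / q%:F) = (p^`() * q - p * q^`())%:F / (q ^+ 2)%:F.
Proof.
move=> q0; rewrite /ratderiv; have := ratnumden_cross p q0.
have := ratden_neq0 (p%:F / q%:F).
set a := ratnum _; set b := ratden _ => b0 e.
have e' : a^`() * q + a * q^`() = p^`() * b + p * b^`() by rewrite -!derivM e.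
apply/eqP; rewrite eqr_div ?tofrac_eq0 ?expf_neq0 // -!tofracM tofrac_eq.
rewrite -subr_eq0; apply/eqP.
transitivity (b * q * (a^`() * q + a * q^`() - (p^`() * b + p * b^`()))
  - (b * q^`() + b^`() * q) * (a * q - p * b)); first by ring.
by rewrite e' e !subrr !mulr0 subrr.
Qed.

Lemma ratval_laurent p n z : z != 0 -> ratval (laurent p n) z = p.[z] / z ^+ n.
Proof.
move=> z0; rewrite /laurent -tofracXn ratval_frac hornerXn //.
by rewrite expf_neq0.
Qed.

Lemma ratderiv_laurent p n :
  ratderiv (laurent p n) = laurent (p^`() * 'X - p *+ n) n.+1.
Proof.
rewrite /laurent -!tofracXn ratderiv_frac ?expf_neq0 ?polyX_eq0 //.
apply/eqP; rewrite eqr_div ?tofrac_eq0 ?expf_neq0 ?polyX_eq0 //.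
rewrite -!tofracM tofrac_eq derivXn; apply/eqP; case: n => [|n].
  by rewrite !mulr0n expr0 expr1n !subr0 mulr0 subr0 !mulr1 expr1.
rewrite -[p *+ _]mulr_natr -['X^_ *+ _]mulr_natr /= !exprS expr0.
by ring.
Qed.

Lemma ratcompE P f z : is_laurent f -> z != 0 ->
  ratval (ratcomp P f) z = P.[ratval f z].
Proof.
move=> [p [n ->]] z0; rewrite ratval_laurent // /laurent -tofracXn.
have : ('X^n : {poly F}).[z] != 0 by rewrite hornerXn expf_neq0.
rewrite -[z ^+ n]hornerXn; move: ('X^n : {poly F}) => q qz.
suff [r [s [-> sz <-]]] : exists r s : {poly F},
    [/\ ratcomp P (p%:F / q%:F) = r%:F / s%:F, s.[z] != 0
      & r.[z] / s.[z] = P.[p.[z] / q.[z]]] by rewrite ratval_frac.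
have q0 : q != 0 by apply: contraNneq qz => ->; rewrite horner0.
elim/poly_ind: P => [|P c [r [s [e sz IH]]]].
  exists 0, 1; rewrite /ratcomp !rmorph0 !horner0 !mul0r hornerE.
  by split=> //; exact: oner_neq0.
have s0 : s != 0 by apply: contraNneq sz => ->; rewrite horner0.
exists (r * p + c%:P * (s * q)), (s * q); split.
- rewrite /ratcomp rmorphD rmorphM /= map_polyX map_polyC /= hornerMXaddC.
  rewrite -/(ratcomp _ _) e /ratconst tofracD !tofracM mulrDl mulf_div.
  by rewrite mulfK // mulf_neq0 // tofrac_eq0.
- by rewrite hornerM mulf_neq0.
- rewrite hornerMXaddC -IH !(hornerD, hornerM, hornerC) mulrDl mulf_div.
  by rewrite mulfK // mulf_neq0.
Qed.
End RationalFunctions.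

Section ContourIntegral.
Variable R : realType.
Local Open Scope complex_scope.

Definition circle (t : R) : R[i] := cos t +i* sin t.

(* The integral over the unit circle, counterclockwise, with z = circle t and
   dz = (- sin t + i cos t) dt. *)
Definition circle_integral (f : R[i] -> R[i]) : R[i] :=
  let g t := f (circle t) * (- sin t +i* cos t) in
  (\int[lebesgue_measure]_(t in `[0%R, 2 * pi]%classic) complex.Re (g t))
  +i* (\int[lebesgue_measure]_(t in `[0%R, 2 * pi]%classic) complex.Im (g t)).

End ContourIntegral.

Section Data.
Variable R : realType.
Local Open Scope complex_scope.

Definition sqrt5 : R[i] := (Num.sqrt 5)%:C.

Definition coefK : R[i] := (11 + 5 * sqrt5) / 216.
Definition zeroA : R[i] := (- 3 + sqrt5) / 2.
Definition zeroB : R[i] := (7 - 3 * sqrt5) / 2.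

Definition L : {fraction {poly R[i]}} :=
  laurent (coefK *: (('X - 1) ^+ 6 * ('X - zeroA%:P) ^+ 3 * ('X - zeroB%:P))) 5.

Definition Q0 : {fraction {poly R[i]}} := 1.

Definition Q1 : {fraction {poly R[i]}} := laurent ('X^2 + 1) 1.

Definition Q2 : {fraction {poly R[i]}} :=
  laurent (- (9 + 4 * sqrt5) *: 'X^4 + (20 + 8 * sqrt5) *: 'X^3 + 1) 2.

Definition Q3 : {fraction {poly R[i]}} :=
  laurent ((47 / 2 + 21 / 2 * sqrt5) *: 'X^6
           - (195 / 2 + 87 / 2 * sqrt5) *: 'X^5
           + (255 / 2 + 111 / 2 * sqrt5) *: 'X^4 + 1) 3.

Definition Q4 : {fraction {poly R[i]}} :=
  laurent (- (9 + 4 * sqrt5) *: 'X^8 + (130 + 58 * sqrt5) *: 'X^7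
           - (630 + 282 * sqrt5) *: 'X^6 + (910 + 406 * sqrt5) *: 'X^5 + 1) 4.

End Data.

(* Main.v *)
Require Import Defs.
From mathcomp Require Import all_boot all_order all_algebra.
From mathcomp Require Import complex.
From mathcomp Require Import all_classical all_reals all_analysis.
From mathcomp Require Import ring zify.

Set Implicit Arguments.
Unset Strict Implicit.
Unset Printing Implicit Defensive.

Import Order.TTheory GRing.Theory Num.Theory.
Local Open Scope ring_scope.

(** Let P(x) = (x + 3/2)^3 (x - 7/2)^2 / 108. Over C[z, 1/z] the polynomial
    P(X) - L(z) is divisible by a quadratic X^2 - sX + p with s = z + 1/z, so the
    ten points of the fibre of L over a generic t are the unordered pairs {x1, x2} of
    distinct roots of P(x) = t. The Laurent polynomials in the module spanned by
    Q0, ..., Q4 over C[L] are exactly the traces g(x1) + g(x2), with g in C[x]: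
    each Qj is a combination of the power sums x1^k + x2^k with k <= 4, and
    multiplying by L amounts to multiplying g by P.

    Traces are orthogonal to the powers of L because
    L^i d(g(x1) + g(x2)) is the sum of P(x)^i g'(x) dx over x = x1, x2, and
    P^i g' has a primitive G in C[x]; so this form is the exact form
    d(G(x1) + G(x2)) and has no residue ([exact_trace]).

    Conversely, L^a Qj has a pole of order 5a + j at 0, so an orthogonal Laurent
    polynomial can be reduced modulo the module to a polynomial, and what remains
    is that an orthogonal polynomial is constant: if q in C[z] and the constant
    term of L^i q is zero for all i >= 0, then q = 0 (apply this to q = z Q').
    Linear algebra reduces this claim from C to any residue field of Z[phi], phi
    the golden ratio, since L is, up to a scalar factor, defined over Z[phi]:
    finitely many i suffice for each degree, and a minor that is nonzero after
    reduction was nonzero before ([moments_vanish_specialize]). Over the field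
    with 11 elements, where phi may be taken to be 4, one argues by descent
    on the degree m of q ([descent]). As L(z)^11 = L(z^11), retaining in L^j q
    only the exponents divisible by 11, and dividing these by 11, preserves the
    hypothesis. Choosing j < 11 with m + 5j divisible by 11 keeps the leading
    term: the result has degree e = (m + 5j) / 11, and 0 < e < m when m > 5. Its
    pole at 0 has order less than e and less than 5, so it can be cancelled with
    multiples of z Q1', ..., z Q4', whose degrees do not exceed their pole orders and
    are therefore too small to affect the leading term. This leaves degree at most 5,
    where the constant terms of L q, ..., L^5 q determine q because their matrix is
    invertible modulo 11. *)

(** * Contour integrals of Laurent polynomials *)

Section CircleIntegral.
Variable R : realType.
Import numFieldNormedType.Exports.
Local Notation mu := (@lebesgue_measure R).
Local Open Scope complex_scope.

Lemma is_derive_sin_scale (j t : R) :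
  is_derive t 1 (fun u => sin (j * u)) (j * cos (j * t)).
Proof.
have dj : is_derive t 1 ( *%R j) j.
  by have := is_deriveZ (f := id) j (is_derive_id t 1); rewrite /GRing.scale /= mulr1.
by rewrite mulrC; exact: (is_derive1_comp (is_derive_sin (j * t)) dj).
Qed.

Lemma is_derive_cos_scale (j t : R) :
  is_derive t 1 (fun u => cos (j * u)) (- (j * sin (j * t))).
Proof.
have dj : is_derive t 1 ( *%R j) j.
  by have := is_deriveZ (f := id) j (is_derive_id t 1); rewrite /GRing.scale /= mulr1.
by rewrite mulrC -mulNr; exact: (is_derive1_comp (is_derive_cos (j * t)) dj).
Qed.

Lemma integral_trig_sum (N n : nat) (a b : nat -> R) :
  \int[mu]_(t in `[0%R, 2 * pi]%classic)
     (\sum_(k < N) (a k * cos ((k%:R - n%:R) * t)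
                    + b k * sin ((k%:R - n%:R) * t)))
  = (if (n < N)%N then a n else 0) * (2 * pi).
Proof.
pose j (k : nat) : R := k%:R - n%:R.
pose f (k : nat) (t : R) := a k * cos (j k * t) + b k * sin (j k * t).
pose F (k : nat) (t : R) : R := if k == n then a k * t else
   (a k / j k) * sin (j k * t) + (- b k / j k) * cos (j k * t).
have dF (k : nat) (t : R) : is_derive t 1 (F k) (f k t).
  rewrite /F /f; case: eqP => [->|/eqP kn].
    rewrite /j subrr mul0r cos0 sin0 mulr0 addr0.
    exact: (is_deriveZ (a n) (is_derive_id t 1)).
  have j0 : j k != 0 by rewrite subr_eq0 eqr_nat.
  have := is_deriveD (is_deriveZ (a k / j k) (is_derive_sin_scale (j k) t))
    (is_deriveZ (- b k / j k) (is_derive_cos_scale (j k) t)).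
  rewrite /GRing.scale /= mulrA divfK // mulrN mulrA divfK //.
  by rewrite [X in a k * _ - X]mulNr opprK; exact.
have dS (t : R) : is_derive t 1 (fun t => \sum_(k < N) F k t) (\sum_(k < N) f k t).
  have := is_derive_sum (h := fun k : 'I_N => F k) (fun k => dF k t).
  rewrite (_ : \sum_(i < N) F i = fun t => \sum_(k < N) F k t) //.
  by apply/funext => u; rewrite fct_sumE.
have cF : continuous (fun t => \sum_(k < N) F k t).
  by move=> t; apply/differentiable_continuous/derivable1_diffP/ex_derive.
have cf : continuous (fun t => \sum_(k < N) f k t).
  move=> t; apply/differentiable_continuous/derivable1_diffP.
  have df (k : nat) : is_derive t 1 (f k)
      (a k * - (j k * sin (j k * t)) + b k * (j k * cos (j k * t))).
    exact: is_deriveD (is_deriveZ (a k) (is_derive_cos_scale (j k) t))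
      (is_deriveZ (b k) (is_derive_sin_scale (j k) t)).
  have := @ex_derive _ _ _ _ _ _ _ (is_derive_sum (h := fun k : 'I_N => f k) (fun k => df k)).
  rewrite (_ : \sum_(i < N) f i = fun t => \sum_(k < N) f k t) //.
  by apply/funext => u; rewrite fct_sumE.
rewrite /Rintegral (@continuous_FTC2 _ _ (fun t => \sum_(k < N) F k t)).
- rewrite -EFinB /= -sumrB.
  under eq_bigr => k _.
    rewrite (_ : F k _ - _ = if k == n :> nat then a n * (2 * pi) else 0).
      over.
    rewrite /F; case: eqP => [->|_]; first by rewrite mulr0 subr0.
    rewrite !mulr0 sin0 cos0.
    have trig (m : nat) : cos (m%:R * (2 * pi)) = 1 :> R
                       /\ sin (m%:R * (2 * pi)) = 0 :> R.
      elim: m => [|m [IHc IHs]]; first by rewrite mul0r cos0 sin0.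
      rewrite -natr1 mulrDl mul1r cosD sinD IHc IHs.
      by rewrite mulr_natl cos2pi sin2pi; split; ring.
    have [ck sk] := trig k; have [cn sn] := trig n.
    rewrite /j mulrBl cosB sinB ck sk cn sn; ring.
  rewrite -big_mkcond /=; case: ltnP => nN.
    by rewrite (big_pred1 (Ordinal nN)) // => i; rewrite -val_eqE.
  rewrite big_pred0 ?mul0r // => i; apply/negbTE; apply: contraTneq nN => <-.
  by rewrite -ltnNge.
- by rewrite mulr_gt0 // pi_gt0.
- exact: continuous_subspaceT.
- split.
  + by move=> t _; apply: ex_derive.
  + by apply: cvg_at_right_filter; exact: cF.
  + by apply: cvg_at_left_filter; exact: cF.
- by move=> t _; rewrite derive1E; apply: derive_val.
Qed.

Lemma circleD (s t : R) : circle (s + t) = circle s * circle t.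
Proof.
by rewrite /circle cosD sinD; apply/eqP; rewrite eq_complex /= addrC !eqxx addrC eqxx.
Qed.

Lemma circle0 : circle (0 : R) = 1.
Proof. by rewrite /circle cos0 sin0. Qed.

Lemma circleX (t : R) n : circle t ^+ n = circle (n%:R * t).
Proof.
elim: n => [|n IH]; first by rewrite mul0r circle0.
by rewrite exprSr IH -circleD -natr1 mulrDl mul1r.
Qed.

Lemma circle_neq0 (t : R) : circle t != 0.
Proof.
apply/eqP => c0; have := circleD t (- t).
by rewrite subrr circle0 c0 mul0r => /eqP; rewrite oner_eq0.
Qed.

Lemma circle_expV (t : R) k n :
  circle t ^+ k / circle t ^+ n = circle ((k%:R - n%:R) * t).
Proof.
have c0 := circle_neq0 t.
apply: (mulIf (x := circle t ^+ n)); first by rewrite expf_neq0.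
by rewrite divfK ?expf_neq0 // !circleX -circleD mulrBl subrK.
Qed.

(** On the circle every term of r / z^(n+1) other than that in 1/z integrates to a
    trigonometric monomial of nonzero frequency. *)
Lemma circle_integral_residue (r : {poly R[i]}) (n : nat) (f : R[i] -> R[i]) :
  (forall z, z != 0 -> f z = r.[z] / z ^+ n.+1) ->
  circle_integral f = (2 * pi)%:C * ('i * r`_n).
Proof.
move=> fE; rewrite /circle_integral.
have gE (t : R) : f (circle t) * (- sin t +i* cos t) =
    \sum_(k < size r) ('i * r`_k) * circle ((k%:R - n%:R) * t).
  have -> : - sin t +i* cos t = 'i * circle t.
    by apply/eqP; rewrite eq_complex /= !mul0r !mul1r sub0r add0r !eqxx.
  rewrite fE ?circle_neq0 // horner_coef mulr_suml mulr_suml.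
  apply: eq_bigr => k _; rewrite -circle_expV exprSr invfM.
  have := circle_neq0 t; set c := circle t => c0.
  have := expf_neq0 n c0; move: (c ^+ n) => d d0; field.
  by rewrite c0 d0.
have ReS (I : Type) (s : seq I) (F : I -> R[i]) :
    complex.Re (\sum_(i <- s) F i) = \sum_(i <- s) complex.Re (F i).
  elim: s => [|x s IH]; rewrite ?big_nil // !big_cons -IH.
  by case: (F x) => ? ?; case: (\sum_(i <- s) F i).
have ImS (I : Type) (s : seq I) (F : I -> R[i]) :
    complex.Im (\sum_(i <- s) F i) = \sum_(i <- s) complex.Im (F i).
  elim: s => [|x s IH]; rewrite ?big_nil // !big_cons -IH.
  by case: (F x) => ? ?; case: (\sum_(i <- s) F i).
pose c k : R[i] := 'i * r`_k.
have -> : 'i * r`_n = c n by [].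
have cn : c n = if (n < size r)%N then c n else 0.
  by case: ltnP => // rn; rewrite /c nth_default // mulr0.
transitivity (((if (n < size r)%N then complex.Re (c n) else 0) * (2 * pi))
   +i* ((if (n < size r)%N then complex.Im (c n) else 0) * (2 * pi))).
  congr (_ +i* _).
    rewrite -(integral_trig_sum _ _ (fun k => complex.Re (c k)) (fun k => - complex.Im (c k))).
    apply: eq_Rintegral => t _; rewrite gE ReS; apply: eq_bigr => k _.
    by rewrite -/(c k) /circle; case: (c k) => x y /=; rewrite mulNr.
  rewrite -(integral_trig_sum _ _ (fun k => complex.Im (c k)) (fun k => complex.Re (c k))).
  apply: eq_Rintegral => t _; rewrite gE ImS; apply: eq_bigr => k _.
  by rewrite -/(c k) /circle; case: (c k) => x y /=; rewrite addrC.
rewrite [in RHS]cn; case: ifP => _; last by rewrite !mul0r mulr0.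
case: (c n) => x y; apply/eqP; rewrite eq_complex /=.
by rewrite !mul0r subr0 addr0 ![_ * (2 * pi)]mulrC !eqxx.
Qed.

End CircleIntegral.

(** * The derivation of rational functions *)

Lemma quotient_rule_add (K : fieldType) (a b c d a' b' c' d' : K) :
  b != 0 -> d != 0 ->
  ((a' * d + a * d' + (c' * b + c * b')) * (b * d)
     - (a * d + c * b) * (b' * d + b * d')) / (b * d) ^+ 2
  = (a' * b - a * b') / b ^+ 2 + (c' * d - c * d') / d ^+ 2.
Proof. by move=> b0 d0; field; rewrite b0 d0. Qed.

Lemma quotient_rule_mul (K : fieldType) (a b c d a' b' c' d' : K) :
  b != 0 -> d != 0 ->
  ((a' * c + a * c') * (b * d) - a * c * (b' * d + b * d')) / (b * d) ^+ 2
  = (a' * b - a * b') / b ^+ 2 * (c / d) + a / b * ((c' * d - c * d') / d ^+ 2).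
Proof. by move=> b0 d0; field; rewrite b0 d0. Qed.

Section Derivation.
Variable F : fieldType.
Local Notation K := {fraction {poly F}}.
Implicit Types (f g : K) (p q : {poly F}).
Local Notation "x %:F" := (tofrac x).

Lemma ratderivE p q : q != 0 ->
  ratderiv (p%:F / q%:F) = (p^`()%:F * q%:F - p%:F * q^`()%:F) / q%:F ^+ 2.
Proof. by move=> q0; rewrite ratderiv_frac // tofracXn tofracB !tofracM. Qed.

Lemma ratderivD f g : ratderiv (f + g) = ratderiv f + ratderiv g.
Proof.
have := ratden_neq0 f; have := ratden_neq0 g.
rewrite {2 3}[f]ratnumden {2 3}[g]ratnumden.
move: (ratnum f) (ratden f) (ratnum g) (ratden g) => a b c d d0 b0.
have bF : b%:F != 0 by rewrite tofrac_eq0.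
have dF : d%:F != 0 by rewrite tofrac_eq0.
have -> : a%:F / b%:F + c%:F / d%:F = (a * d + c * b)%:F / (b * d)%:F.
  by rewrite (addf_div _ _ bF dF) tofracD !tofracM.
have bd0 : b * d != 0 by rewrite mulf_neq0.
rewrite (ratderivE _ bd0) (ratderivE _ b0) (ratderivE _ d0) derivD !derivM.
move: (a^`()) (b^`()) (c^`()) (d^`()) => a' b' c' d'.
rewrite !tofracD !tofracM.
exact: (@quotient_rule_add K _ _ _ _ _ _ _ _ bF dF).
Qed.

Lemma ratderivM f g : ratderiv (f * g) = ratderiv f * g + f * ratderiv g.
Proof.
have := ratden_neq0 f; have := ratden_neq0 g.
rewrite {2 3 4}[f]ratnumden {2 3 4}[g]ratnumden.
move: (ratnum f) (ratden f) (ratnum g) (ratden g) => a b c d d0 b0.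
have bF : b%:F != 0 by rewrite tofrac_eq0.
have dF : d%:F != 0 by rewrite tofrac_eq0.
have -> : a%:F / b%:F * (c%:F / d%:F) = (a * c)%:F / (b * d)%:F.
  by rewrite mulf_div !tofracM.
have bd0 : b * d != 0 by rewrite mulf_neq0.
rewrite (ratderivE _ bd0) (ratderivE _ b0) (ratderivE _ d0) !derivM.
move: (a^`()) (b^`()) (c^`()) (d^`()) => a' b' c' d'.
rewrite !tofracD !tofracM.
exact: (@quotient_rule_mul K _ _ _ _ _ _ _ _ bF dF).
Qed.

Lemma ratderiv_const c : ratderiv (ratconst c : K) = 0.
Proof.
have d1 : (1 : {poly F})^`() = 0 by rewrite -polyC1 derivC.
have -> : ratconst c = (c%:P)%:F / 1%:F by rewrite tofrac1 divr1.
by rewrite (ratderivE _ (oner_neq0 _)) derivC d1 tofrac0 mul0r mulr0 subrr mul0r.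
Qed.
End Derivation.

(** * Recurrent sequences of order two and power sums of a pair *)

Section LinearRecurrence.
Variables (F : nzRingType) (K : comNzRingType) (iota : {rmorphism F -> K}).
Variables (s p : K).
Implicit Types (v w : nat -> K) (g : {poly F}) (P : {poly F}).

Definition recurrent v := forall k, v k.+2 = s * v k.+1 - p * v k.

Fixpoint linrec (a b : K) (n : nat) : K :=
  if n is m.+1 then linrec b (s * b - p * a) m else a.

Lemma linrecP a b : recurrent (linrec a b).
Proof. by move=> k; elim: k a b => [|k IH] a b //; rewrite -IH. Qed.

Lemma recurrentD v w : recurrent v -> recurrent w -> recurrent (fun k => v k + w k).
Proof. by move=> Hv Hw k; rewrite Hv Hw; ring. Qed.

Lemma recurrentZ c v : recurrent v -> recurrent (fun k => c * v k).
Proof. by move=> Hv k; rewrite Hv; ring. Qed.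

Lemma recurrent_shift v : recurrent v -> recurrent (fun k => v k.+1).
Proof. by move=> Hv k; rewrite Hv. Qed.

Lemma recurrent_eq v w : recurrent v -> recurrent w ->
  v 0%N = w 0%N -> v 1%N = w 1%N -> v =1 w.
Proof.
move=> Hv Hw e0 e1 k.
suff : v k = w k /\ v k.+1 = w k.+1 by case.
by elim: k => [//|k [IH0 IH1]]; split=> //; rewrite Hv Hw IH0 IH1.
Qed.

(** The umbral evaluation, replacing X^k by v k. If v k = c1 x1^k + c2 x2^k,
    this is c1 g(x1) + c2 g(x2): sums over the two roots x1, x2 of X^2 - sX + p
    are expressed without adjoining these roots. *)
Definition umbral v g : K := \sum_(k < size g) iota g`_k * v k.

Lemma umbralE v g n : (size g <= n)%N -> umbral v g = \sum_(k < n) iota g`_k * v k.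
Proof.
move=> gn; rewrite /umbral (big_ord_widen n (fun k => iota g`_k * v k) gn).
rewrite big_mkcond; apply: eq_bigr => k _; case: ltnP => // sk.
by rewrite nth_default // rmorph0 mul0r.
Qed.

Lemma umbralD v g h : umbral v (g + h) = umbral v g + umbral v h.
Proof.
have gm := leq_maxl (size g) (size h); have hm := leq_maxr (size g) (size h).
rewrite (umbralE v gm) (umbralE v hm) (umbralE v (size_polyD g h)) -big_split.
by apply: eq_bigr => k _; rewrite coefD rmorphD mulrDl.
Qed.

Lemma umbralZ v c g : umbral v (c *: g) = iota c * umbral v g.
Proof.
rewrite (umbralE v (size_scale_leq c g)) /umbral mulr_sumr.
by apply: eq_bigr => k _; rewrite coefZ rmorphM mulrA.
Qed.

Lemma umbral0 v : umbral v 0 = 0.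
Proof. by rewrite /umbral size_poly0 big_ord0. Qed.

Lemma umbralC v c : umbral v c%:P = iota c * v 0%N.
Proof. by rewrite (umbralE v (size_polyC_leq1 c)) big_ord1 coefC. Qed.

Lemma umbralMX v g : umbral v (g * 'X) = umbral (fun k => v k.+1) g.
Proof.
have gs : (size (g * 'X)%R <= (size g).+1)%N.
  have [->|g0] := eqVneq g 0; first by rewrite mul0r size_poly0.
  by rewrite size_mulX.
rewrite (umbralE v gs) big_ord_recl coefMX /= rmorph0 mul0r add0r.
by apply: eq_bigr => k _; rewrite coefMX.
Qed.

(** If P acts as the scalar c on every recurrent sequence -- that is, if P is
    congruent to c modulo X^2 - sX + p -- then multiplying by P before applying
    a recurrent sequence amounts to multiplying by c. *)
Lemma umbralM v g P c : (forall w, recurrent w -> umbral w P = c * w 0%N) ->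
  recurrent v -> umbral v (g * P) = c * umbral v g.
Proof.
move=> HP; elim/poly_ind: g v => [|g a IH] v Hv.
  by rewrite mul0r umbral0 mulr0.
rewrite mulrDl -mulrA -['X * P]commr_polyX mulrA umbralD umbralMX.
rewrite (IH _ (recurrent_shift Hv)) mul_polyC umbralZ HP //.
rewrite umbralD umbralMX umbralC; ring.
Qed.

Lemma umbralXM v g P c n : (forall w, recurrent w -> umbral w P = c * w 0%N) ->
  recurrent v -> umbral v (g * P ^+ n) = c ^+ n * umbral v g.
Proof.
move=> HP Hv; elim: n => [|n IH]; first by rewrite mulr1 mul1r.
by rewrite exprSr mulrA (umbralM _ HP Hv) IH exprS mulrA.
Qed.

(** The sequence x1^k + x2^k. *)
Definition powersum : nat -> K := linrec 2 s.

Section PowersumDerivation.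
Variable D : K -> K.
Hypothesis DD : forall a b, D (a + b) = D a + D b.
Hypothesis DM : forall a b, D (a * b) = D a * b + a * D b.
Hypothesis D_iota : forall c, D (iota c) = 0.

(** The sequence x1^k D(x1) + x2^k D(x2). *)
Definition dpowersum : nat -> K := linrec (D s) (s * D s - D p).

Lemma D_sum n (f : 'I_n -> K) : D (\sum_(k < n) f k) = \sum_(k < n) D (f k).
Proof.
have D0 : D 0 = 0 by have := D_iota 0; rewrite rmorph0.
by elim/big_rec2: _ => [//|k x y _ <-]; rewrite DD.
Qed.

(** Both sides are computed in terms of the sequence H = 0, 1, s, ... of complete
    homogeneous polynomials in x1, x2, that is (x1^k - x2^k) / (x1 - x2). *)
Lemma D_powersum k : D (powersum k.+1) = k.+1%:R * dpowersum k.
Proof.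
have DN f : D (- f) = - D f.
  have D0 : D 0 = 0 by have := D_iota 0; rewrite rmorph0.
  by apply/eqP; rewrite -addr_eq0 -DD addNr D0.
pose H := linrec 0 1; have HH : recurrent H := linrecP _ _.
have Hp : recurrent powersum := linrecP _ _.
have Hu : recurrent dpowersum := linrecP _ _.
have e1 j : powersum j.+1 = s * H j.+1 - 2 * p * H j.
  have hS : recurrent (fun j => s * H j.+1 + (- 2 * p) * H j).
    exact: recurrentD (recurrentZ _ (recurrent_shift HH)) (recurrentZ _ HH).
  rewrite (recurrent_eq (recurrent_shift Hp) hS) /powersum /H /=; ring.
have e2 j : dpowersum j = D s * H j.+1 - D p * H j.
  have hS : recurrent (fun j => D s * H j.+1 + (- D p) * H j).
    exact: recurrentD (recurrentZ _ (recurrent_shift HH)) (recurrentZ _ HH).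
  rewrite (recurrent_eq Hu hS) /dpowersum /H /=; ring.
suff : D (powersum k.+1) = k.+1%:R * dpowersum k
    /\ D (powersum k.+2) = k.+2%:R * dpowersum k.+1 by case.
elim: k => [|k [IH1 IH2]]; split=> //.
- by rewrite /powersum /dpowersum /= mul1r.
- have D2 : D 2 = 0 by rewrite -(rmorph_nat iota 2) D_iota.
  rewrite /powersum /dpowersum /= DD DN !DM D2; ring.
- rewrite Hp DD DN !DM IH1 IH2 Hu (e1 k.+1) (e1 k) !(e2 k.+1) (e2 k) !HH -!natr1.
  ring.
Qed.

(** The chain rule D(g(x1) + g(x2)) = g'(x1) D(x1) + g'(x2) D(x2). *)
Lemma D_umbral_powersum g : D (umbral powersum g) = umbral dpowersum g^`().
Proof.
have D0 : D (powersum 0) = 0 by rewrite /powersum /= -(rmorph_nat iota 2) D_iota.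
rewrite (umbralE _ (leqnSn _)) big_ord_recl DD DM D_iota D0 mul0r mulr0.
have gs : (size g^`() <= size g)%N.
  by have [->|/lt_size_deriv/ltnW//] := eqVneq g 0; rewrite deriv0.
rewrite !add0r D_sum (umbralE _ gs); apply: eq_bigr => k _ /=.
by rewrite DM D_iota mul0r add0r D_powersum coef_deriv rmorphMn mulrA mulr_natr.
Qed.
End PowersumDerivation.
End LinearRecurrence.

(** * The quintic equation resolved by L *)

Section QuinticIdentities.
Variables (K : fieldType) (z r : K).
Hypotheses (z0 : z != 0) (r5 : r ^+ 2 = 5) (n2 : 2 != 0 :> K) (n3 : 3 != 0 :> K).

(** The sum and the product of the pair attached to z. At the zeros 1, a, b of L the
    pair is {-3/2, 7/2}, {-3/2, -3/2} and {7/2, 7/2}; together with the leading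
    terms of p at 0 and at infinity this determines p, given s. *)
Definition pair_sum : K := z + z^-1.
Definition pair_prod : K :=
  (3 + r) / 2 * z ^+ 2 - (5 / 2 + r) * z - 13 / 4
    + (r - 5 / 2) * z^-1 + (3 - r) / 2 * z ^- 2.

Local Notation pw := (powersum pair_sum pair_prod).

Let nz23 k l : 2 ^+ k * 3 ^+ l != 0 :> K.
Proof. by rewrite mulf_neq0 ?expf_neq0. Qed.

Let nz (m : nat) k l : m = (2 ^ k * 3 ^ l)%N -> m%:R != 0 :> K.
Proof. by move=> ->; rewrite natrM !natrX nz23. Qed.

Let nzE := ((nz (m := 2) (k := 1) (l := 0) erefl, nz (m := 4) (k := 2) (l := 0) erefl,
 nz (m := 8) (k := 3) (l := 0) erefl, nz (m := 16) (k := 4) (l := 0) erefl,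
 nz (m := 48) (k := 4) (l := 1) erefl, nz (m := 64) (k := 6) (l := 0) erefl),
 nz (m := 108) (k := 2) (l := 3) erefl, nz (m := 128) (k := 7) (l := 0) erefl,
 nz (m := 216) (k := 3) (l := 3) erefl).

(** By the recurrence both sides are combinations of v 0 and v 1; comparing
    coefficients says that X^2 - sX + p divides P(X) - L(z). The numbers on the left
    are the coefficients of P. *)
Lemma quintic_recurrent v : recurrent pair_sum pair_prod v ->
  49 / 128 * v 0%N + 35 / 64 * v 1%N + 5 / 48 * v 2%N - 25 / 216 * v 3%N
    - 5 / 216 * v 4%N + 1 / 108 * v 5%N
  = (11 + 5 * r) / 216 * ((z - 1) ^+ 6 * (z - (- 3 + r) / 2) ^+ 3
      * (z - (7 - 3 * r) / 2)) / z ^+ 5 * v 0%N.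
Proof.
move=> Hv; rewrite (Hv 3%N) (Hv 2%N) (Hv 1%N) (Hv 0%N) /pair_sum /pair_prod; field : r5.
by rewrite z0 !nzE.
Qed.

(** In this and the next two identities the coefficients of the power sums are forced
    by the polar and constant terms at z = 0; the positive powers of z then agree. *)
Lemma Q2_powersum :
  (- (9 + 4 * r) * z ^+ 4 + (20 + 8 * r) * z ^+ 3 + 1) / z ^+ 2
  = (2 + r) * pw 2 - r * pw 1 - (17 / 2 + 17 / 4 * r) * pw 0.
Proof.
rewrite /powersum /= /pair_sum /pair_prod; field : r5.
by rewrite z0 !nzE.
Qed.

Lemma Q3_powersum :
  ((47 / 2 + 21 / 2 * r) * z ^+ 6 - (195 / 2 + 87 / 2 * r) * z ^+ 5
    + (255 / 2 + 111 / 2 * r) * z ^+ 4 + 1) / z ^+ 3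
  = - (7 / 2 + 3 / 2 * r) * pw 3 + (45 / 4 + 21 / 4 * r) * pw 2
    + (291 / 8 + 111 / 8 * r) * pw 1 - (345 / 16 + 177 / 16 * r) * pw 0.
Proof.
rewrite /powersum /= /pair_sum /pair_prod; field : r5.
by rewrite z0 !nzE.
Qed.

Lemma Q4_powersum :
  (- (9 + 4 * r) * z ^+ 8 + (130 + 58 * r) * z ^+ 7 - (630 + 282 * r) * z ^+ 6
    + (910 + 406 * r) * z ^+ 5 + 1) / z ^+ 4
  = - (2 + r) * pw 4 - (10 + 4 * r) * pw 3 + (112 + 103 / 2 * r) * pw 2
    + (185 / 2 + 36 * r) * pw 1 - (2807 / 8 + 2621 / 16 * r) * pw 0.
Proof.
rewrite /powersum /= /pair_sum /pair_prod; field : r5.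
by rewrite z0 !nzE.
Qed.

End QuinticIdentities.

(** * Laurent polynomials and residues *)

Section LaurentSubring.
Variable F : fieldType.
Local Notation K := {fraction {poly F}}.
Implicit Types f g : K.
Local Notation "x %:F" := (tofrac x).

Lemma fracX_neq0 n : ('X : {poly F})%:F ^+ n != 0.
Proof. by rewrite expf_neq0 // tofrac_eq0 polyX_eq0. Qed.

Lemma is_laurentD f g : is_laurent f -> is_laurent g -> is_laurent (f + g).
Proof.
move=> [p [n ->]] [q [m ->]]; exists (p * 'X^m + q * 'X^n), (n + m)%N.
rewrite /laurent tofracD (tofracM p) (tofracM q) !tofracXn.
by rewrite (addf_div _ _ (fracX_neq0 n) (fracX_neq0 m)) exprD.
Qed.

Lemma is_laurentM f g : is_laurent f -> is_laurent g -> is_laurent (f * g).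
Proof.
move=> [p [n ->]] [q [m ->]]; exists (p * q), (n + m)%N.
by rewrite /laurent mulf_div tofracM exprD.
Qed.

Lemma is_laurent_poly (p : {poly F}) : is_laurent (p%:F).
Proof. by exists p, 0%N; rewrite /laurent expr0 divr1. Qed.

Lemma is_laurentN f : is_laurent f -> is_laurent (- f).
Proof.
by move=> [p [n ->]]; exists (- p), n; rewrite /laurent tofracN mulNr.
Qed.

Lemma is_laurentVX n : is_laurent (('X : {poly F})%:F ^- n).
Proof. by exists 1, n; rewrite /laurent tofrac1 mul1r. Qed.

Lemma is_laurent_umbral (s p a b : K) (g : {poly F}) :
  is_laurent s -> is_laurent p -> is_laurent a -> is_laurent b ->
  is_laurent (umbral (@ratconst F) (linrec s p a b) g).
Proof.
move=> Ls Lp La Lb; rewrite /umbral; elim/big_ind: _ => [||k _].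
- by rewrite -tofrac0; apply: is_laurent_poly.
- exact: is_laurentD.
apply: is_laurentM; first exact: is_laurent_poly.
elim: {k}(k : nat) a b La Lb => [|k IH] a b La Lb //=; apply: IH => //.
by apply: is_laurentD; [|apply: is_laurentN]; exact: is_laurentM.
Qed.

Lemma laurent_inj (p q : {poly F}) n m :
  laurent p n = laurent q m -> p * 'X^m = q * 'X^n.
Proof.
rewrite /laurent => /eqP; rewrite eqr_div ?fracX_neq0 // -!tofracXn -!tofracM.
by rewrite tofrac_eq => /eqP.
Qed.

Lemma residue_ratderiv (q : {poly F}) (n : nat) f :
  is_laurent f -> laurent q n.+1 = ratderiv f -> q`_n = 0.
Proof.
move=> [g [m ->]]; rewrite ratderiv_laurent => /laurent_inj e.
have coefXD (h : {poly F}) i j : (h * 'X^j)`_(i + j) = h`_i.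
  by rewrite coefMXn ltnNge leq_addl addnK.
rewrite -(coefXD q n m.+1) e -addSnnS addnC coefXD coefB coefMX coefMn.
by case: m {e} => [|m]; rewrite ?mulr0n ?subrr // coef_deriv subrr.
Qed.
End LaurentSubring.

(** * The generators as traces *)

Section Generators.
(* theta stands for the embedding of polynomials into rational functions, and iota
   for its restriction to constants. *)
Variables (F K : fieldType) (theta : {rmorphism {poly F} -> K}) (r : F).
Hypotheses (z0 : theta 'X != 0) (r5 : r ^+ 2 = 5).
Hypotheses (n2 : 2 != 0 :> F) (n3 : 3 != 0 :> F).

Let iota : {rmorphism F -> K} := theta \o @polyC F.
Local Notation z := (theta 'X).
Local Notation s := (pair_sum z).
Local Notation p := (pair_prod z (iota r)).

Let r5' : iota r ^+ 2 = 5. Proof. by rewrite -rmorphXn r5 rmorph_nat. Qed.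
Let n2' : 2 != 0 :> K. Proof. by rewrite -(rmorph_nat iota 2) fmorph_eq0. Qed.
Let n3' : 3 != 0 :> K. Proof. by rewrite -(rmorph_nat iota 3) fmorph_eq0. Qed.

(** The polynomial (X + 3/2)^3 (X - 7/2)^2 / 108, whose coefficients appear in
    [quintic_recurrent]. *)
Definition quintic : {poly F} :=
  Poly [:: 49 / 128; 35 / 64; 5 / 48; - (25 / 216); - (5 / 216); 1 / 108].

Let iE c : theta c%:P = iota c. Proof. by []. Qed.

Let iota_div (m n : nat) : iota (m%:R / n%:R) = m%:R / n%:R.
Proof. by rewrite fmorph_div !rmorph_nat. Qed.

Lemma quinticP v : recurrent s p v ->
  umbral iota v quintic = theta (((11 + 5 * r) / 216) *:
     (('X - 1) ^+ 6 * ('X - ((- 3 + r) / 2)%:P) ^+ 3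
      * ('X - ((7 - 3 * r) / 2)%:P))) / z ^+ 5 * v 0%N.
Proof.
move=> Hv; have e1 : theta ('X - 1) = z - 1 by rewrite rmorphB rmorph1.
have eX c : theta ('X - c%:P) = z - iota c by rewrite rmorphB.
rewrite -mul_polyC (rmorphM theta) (rmorphM theta (_ * _)).
rewrite (rmorphM theta (_ ^+ 6)) !(rmorphXn theta) e1 !eX.
have -> : theta ((11 + 5 * r) / 216)%:P = (11 + 5 * iota r) / 216.
  by rewrite iE fmorph_div rmorphD (rmorphM iota) !rmorph_nat.
have -> : iota ((- 3 + r) / 2) = (- 3 + iota r) / 2.
  by rewrite fmorph_div rmorphD (rmorphN iota) !rmorph_nat.
have -> : iota ((7 - 3 * r) / 2) = (7 - 3 * iota r) / 2.
  by rewrite fmorph_div rmorphB (rmorphM iota) !rmorph_nat.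
rewrite -(quintic_recurrent z0 r5' n2' n3' Hv).
rewrite /quintic (umbralE _ _ (size_Poly _)) 5!big_ord_recl big_ord1 !coef_Poly /=.
rewrite !iE !(rmorphN iota) !fmorph_div rmorph1 !rmorph_nat !mulNr.
by rewrite !addrA.
Qed.

Let umbralXn n : umbral iota (powersum s p) 'X^n = powersum s p n.
Proof.
rewrite (umbralE _ _ (n := n.+1)) ?size_polyXn // big_ord_recr /= big1.
  by rewrite coefXn eqxx rmorph1 mul1r add0r.
by move=> k _; rewrite coefXn (ltn_eqF (ltn_ord k)) rmorph0 mul0r.
Qed.

Let mapE c n : theta (c *: 'X^n) = iota c * z ^+ n.
Proof. by rewrite -mul_polyC rmorphM rmorphXn. Qed.

Lemma Q0_umbral : 1 = umbral iota (powersum s p) (2^-1)%:P.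
Proof. by rewrite umbralC /powersum /= iE fmorphV rmorph_nat mulVf. Qed.

Lemma Q1_umbral : theta ('X^2 + 1) / z = umbral iota (powersum s p) 'X.
Proof.
rewrite -['X in RHS]expr1 umbralXn /powersum /= rmorphD rmorph1 rmorphXn.
by rewrite /pair_sum mulrDl mul1r expr2 mulfK.
Qed.

Let iotaE := (rmorph_nat iota, iota_div, rmorphM iota, rmorphN iota, rmorphB iota,
  rmorphD iota).

Lemma Q2_umbral :
  theta (- (9 + 4 * r) *: 'X^4 + (20 + 8 * r) *: 'X^3 + 1) / z ^+ 2
  = umbral iota (powersum s p)
      ((2 + r) *: 'X^2 + (- r) *: 'X^1 + (- (17 / 2 + 17 / 4 * r)) *: 'X^0).
Proof.
rewrite !umbralD !umbralZ !umbralXn !(rmorphD theta) !mapE rmorph1 !iotaE.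
by rewrite (Q2_powersum z0 r5' n2' n3'); ring.
Qed.

Lemma Q3_umbral :
  theta ((47 / 2 + 21 / 2 * r) *: 'X^6 - (195 / 2 + 87 / 2 * r) *: 'X^5
           + (255 / 2 + 111 / 2 * r) *: 'X^4 + 1) / z ^+ 3
  = umbral iota (powersum s p)
      (- (7 / 2 + 3 / 2 * r) *: 'X^3 + (45 / 4 + 21 / 4 * r) *: 'X^2
       + (291 / 8 + 111 / 8 * r) *: 'X^1 + (- (345 / 16 + 177 / 16 * r)) *: 'X^0).
Proof.
rewrite !umbralD !umbralZ !umbralXn !(rmorphD theta) (rmorphN theta) !mapE rmorph1.
by rewrite !iotaE (Q3_powersum z0 r5' n2' n3'); ring.
Qed.

Lemma Q4_umbral :
  theta (- (9 + 4 * r) *: 'X^8 + (130 + 58 * r) *: 'X^7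
           - (630 + 282 * r) *: 'X^6 + (910 + 406 * r) *: 'X^5 + 1) / z ^+ 4
  = umbral iota (powersum s p)
      (- (2 + r) *: 'X^4 + (- (10 + 4 * r)) *: 'X^3 + (112 + 103 / 2 * r) *: 'X^2
       + (185 / 2 + 36 * r) *: 'X^1 + (- (2807 / 8 + 2621 / 16 * r)) *: 'X^0).
Proof.
rewrite !umbralD !umbralZ !umbralXn !(rmorphD theta) (rmorphN theta) !mapE rmorph1.
by rewrite !iotaE (Q4_powersum z0 r5' n2' n3'); ring.
Qed.
End Generators.

(** * Traces are orthogonal to the powers of L *)

Lemma antiderivative (F : numFieldType) (h : {poly F}) : exists G, G^`() = h.
Proof.
exists (\poly_(k < (size h).+1) (if k is j.+1 then h`_j / j.+1%:R else 0)).
apply/polyP => k; rewrite coef_deriv coef_poly ltnS; case: ltnP => [_|hk].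
  by rewrite /= -[LHS]mulr_natr divfK // pnatr_eq0.
by rewrite mul0rn nth_default.
Qed.

Section Orthogonality.
Variable R : realType.
Local Notation C := R[i].
Local Notation K := {fraction {poly C}}.
Local Notation "x %:F" := (tofrac x).

Let theta : {rmorphism {poly C} -> K} := @tofrac {poly C}.
Local Notation z := (('X : {poly C})%:F).
Local Notation r := (sqrt5 R).
Local Notation s := (pair_sum z).
Local Notation p := (pair_prod z (ratconst r)).
Local Notation trace := (umbral (@ratconst C) (powersum s p)).

Lemma sqrt5_sqr : r ^+ 2 = 5.
Proof.
by rewrite /sqrt5 -rmorphXn sqr_sqrtr ?ler0n // rmorph_nat.
Qed.

Let z0 : theta 'X != 0. Proof. by rewrite tofrac_eq0 polyX_eq0. Qed.
Let n2 : 2 != 0 :> C. Proof. by rewrite pnatr_eq0. Qed.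
Let n3 : 3 != 0 :> C. Proof. by rewrite pnatr_eq0. Qed.

Lemma umbral_quintic v : recurrent s p v ->
  umbral (@ratconst C) v (quintic C) = L R * v 0%N.
Proof. exact: (quinticP z0 sqrt5_sqr n2 n3). Qed.

Lemma ratcompMXaddC P c (f : K) :
  ratcomp (P * 'X + c%:P) f = ratcomp P f * f + ratconst c.
Proof. by rewrite /ratcomp rmorphD rmorphM /= map_polyX map_polyC hornerMXaddC. Qed.

Lemma ratcomp_trace P g : ratcomp P (L R) * trace g = trace (g * (P \Po quintic C)).
Proof.
elim/poly_ind: P => [|P c IH].
  by rewrite comp_poly0 mulr0 umbral0 /ratcomp rmorph0 horner0 mul0r.
rewrite comp_poly_MXaddC mulrDr mulrA umbralD.
rewrite (umbralM _ umbral_quintic (linrecP _ _ _ _)) -IH.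
rewrite [g * c%:P]mulrC mul_polyC umbralZ ratcompMXaddC mulrDl.
by congr (_ + _); rewrite [ratcomp P _ * _]mulrC mulrA.
Qed.

Lemma module_trace R0 R1 R2 R3 R4 : exists g,
  ratcomp R0 (L R) * Q0 R + ratcomp R1 (L R) * Q1 R
       + ratcomp R2 (L R) * Q2 R + ratcomp R3 (L R) * Q3 R
       + ratcomp R4 (L R) * Q4 R = trace g.
Proof.
have [g0 e0] : exists g, Q0 R = trace g by eexists; exact: (Q0_umbral _ _ n2).
have [g1 e1] : exists g, Q1 R = trace g.
  by eexists; rewrite /Q1 /laurent expr1; exact: (Q1_umbral _ z0).
have [g2 e2] : exists g, Q2 R = trace g.
  by eexists; exact: (Q2_umbral z0 sqrt5_sqr n2 n3).
have [g3 e3] : exists g, Q3 R = trace g.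
  by eexists; exact: (Q3_umbral z0 sqrt5_sqr n2 n3).
have [g4 e4] : exists g, Q4 R = trace g.
  by eexists; exact: (Q4_umbral z0 sqrt5_sqr n2 n3).
by eexists; rewrite e0 e1 e2 e3 e4 !ratcomp_trace -!umbralD.
Qed.

Lemma is_laurent_pair_sum : is_laurent s.
Proof.
apply: is_laurentD; first exact: is_laurent_poly.
exact: (is_laurentVX _ 1).
Qed.

Lemma is_laurent_pair_prod : is_laurent p.
Proof.
have LC c : is_laurent (ratconst c : K) by exact: is_laurent_poly.
have LN n : is_laurent (n%:R : K) by rewrite -(rmorph_nat (@ratconst C)); exact: LC.
have LVN n : is_laurent (n%:R^-1 : K).
  by rewrite -(rmorph_nat (@ratconst C)) -fmorphV; exact: LC.
have LX n : is_laurent (z ^+ n) by rewrite -tofracXn; exact: is_laurent_poly.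
have LV n : is_laurent (z ^- n) := is_laurentVX _ n.
have k1 := is_laurentM (is_laurentD (LN 3%N) (LC r)) (LVN 2%N).
have k2 := is_laurentD (is_laurentM (LN 5%N) (LVN 2%N)) (LC r).
have k3 := is_laurentM (LN 13%N) (LVN 4%N).
have k4 := is_laurentD (LC r) (is_laurentN (is_laurentM (LN 5%N) (LVN 2%N))).
have k5 := is_laurentM (is_laurentD (LN 3%N) (is_laurentN (LC r))) (LVN 2%N).
apply: is_laurentD (is_laurentM k5 (LV 2%N)).
apply: is_laurentD (is_laurentM k4 (LV 1%N)).
apply: is_laurentD (is_laurentN k3).
exact: is_laurentD (is_laurentM k1 (LX 2%N)) (is_laurentN (is_laurentM k2 (LX 1%N))).
Qed.

Lemma is_laurent_trace g : is_laurent (trace g).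
Proof.
apply: is_laurent_umbral is_laurent_pair_sum is_laurent_pair_prod _ _.
  by rewrite -(rmorph_nat (@ratconst C)); exact: is_laurent_poly.
exact: is_laurent_pair_sum.
Qed.

(** With G a primitive of P^i g', this is the form P(x)^i g'(x) dx = dG(x) summed over
    x = x1, x2, on which L = P(x1) = P(x2). *)
Lemma exact_trace i g : exists G, L R ^+ i * ratderiv (trace g) = ratderiv (trace G).
Proof.
have DT h : ratderiv (trace h) =
    umbral (@ratconst C) (dpowersum s p (@ratderiv C)) h^`().
  exact: D_umbral_powersum (@ratderivD C) (@ratderivM C) (@ratderiv_const C) h.
have [G GE] := antiderivative (g^`() * quintic C ^+ i); exists G.
by rewrite !DT GE (umbralXM _ _ umbral_quintic (linrecP _ _ _ _)).
Qed.
End Orthogonality.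

(** * Descent on the degree in characteristic p *)

Section Moments.
Variables (A : comNzRingType) (d : nat) (B : {poly A}).
Implicit Types (q y : {poly A}).

(** With L = B / z^d, these coefficients are the constant terms of L^i (q / z^n). *)
Definition moments_vanish (n : nat) q := forall i, (B ^+ i * q)`_(d * i + n) = 0.

Lemma moments_vanishB n q y :
  moments_vanish n q -> moments_vanish n y -> moments_vanish n (q - y).
Proof. by move=> Hq Hy i; rewrite mulrBr coefB Hq Hy subrr. Qed.

Lemma moments_vanishZ n c q : moments_vanish n q -> moments_vanish n (c *: q).
Proof. by move=> Hq i; rewrite -scalerAr coefZ Hq mulr0. Qed.

Lemma moments_vanishMX n q : moments_vanish n.+1 (q * 'X) <-> moments_vanish n q.
Proof. by split=> Hq i; have := Hq i; rewrite mulrA coefMX addnS. Qed.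

Lemma moments_vanish_coef0 q : moments_vanish 0 q -> q`_0 = 0.
Proof. by move=> Hq; have := Hq 0%N; rewrite mul1r muln0. Qed.
End Moments.

Section FrobeniusPoly.
Variables (p : nat) (p_pr : prime p).
Local Notation F := 'F_p.
Implicit Types (b r : {poly F}).

Lemma exp_prime_comp_polyXn b : b ^+ p = b \Po 'X^p.
Proof.
have pcharX : p \in [pchar {poly F}] by rewrite pchar_poly pchar_Fp.
elim/poly_ind: b => [|b c IH].
  by rewrite comp_poly0 expr0n -[p == 0%N]negbK -lt0n prime_gt0.
rewrite comp_poly_MXaddC -IH exprDn_pchar ?pnatE // exprMn.
have pF : p \in [pchar F] by rewrite pchar_Fp.
by rewrite -polyC_exp -[c]natr_Zp -[_%:R ^+ p](pFrobenius_autE pF) pFrobenius_aut_nat.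
Qed.

(** The Cartier operator: the terms whose exponent is a multiple of p, with the
    exponents divided by p. *)
Definition decimate r : {poly F} := \poly_(k < size r) r`_(p * k).

Lemma coef_decimate r k : (decimate r)`_k = r`_(p * k).
Proof.
rewrite coef_poly; case: ltnP => // rk; rewrite nth_default //.
by rewrite (leq_trans rk) // leq_pmull // prime_gt0.
Qed.

Lemma decimateM b r : decimate ((b \Po 'X^p) * r) = b * decimate r.
Proof.
elim/poly_ind: b => [|b c IH].
  rewrite comp_poly0 !mul0r; apply/polyP => k.
  by rewrite coef_decimate !coef0.
apply/polyP => k; rewrite comp_poly_MXaddC coef_decimate !mulrDl !coefD !mul_polyC.
rewrite !coefZ coef_decimate; congr (_ + _).
rewrite mulrAC coefMXn [b * 'X * _]mulrAC coefMX.
case: k => [|k]; first by rewrite muln0 prime_gt0.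
by rewrite -IH coef_decimate mulnS ltnNge leq_addr /= addKn.
Qed.
End FrobeniusPoly.

Section Descent.
Variables (p : nat) (p_pr : prime p) (d : nat) (B : {poly 'F_p}).
Variable (N : nat -> {poly 'F_p}).
Hypothesis d_p : ~~ (p %| d)%N.
Hypothesis sizeB : size B = (d + d).+1.
Hypothesis N_vanish : forall k, (0 < k < d)%N -> moments_vanish d B k (N k).
Hypothesis N_coef0 : forall k, (0 < k < d)%N -> (N k)`_0 != 0.
Hypothesis N_size : forall k, (0 < k < d)%N -> (size (N k) <= (k + k).+1)%N.
Implicit Types (q y : {poly 'F_p}).

(** The Laurent polynomial y / z^c has degree e. Its pole is cancelled one order at
    a time; the hypothesis on y bounds this order by e - 1, so that N k, of degree at
    most k < e once divided by z^k, leaves the leading term alone, and by d - 1, so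
    that some N k is available. *)
Lemma clear_poles c e y : moments_vanish d B c y -> size y = (c + e).+1 ->
  (forall k, (k + e <= c)%N || (k + d <= c)%N -> y`_k = 0) ->
  exists2 q, moments_vanish d B 0 q & size q = e.+1.
Proof.
elim: c y => [|c IH] y Hy sy y0; first by exists y.
have [y1 [H1 s1 z1 c1]] : exists y1, [/\ moments_vanish d B c.+1 y1,
    size y1 = (c.+1 + e).+1, y1`_0 = 0
    & forall k, (k + e <= c)%N || (k + d <= c)%N -> y1`_k.+1 = 0].
  have [/andP[ce cd]|] := boolP ((c.+1 < e) && (c.+1 < d))%N.
    exists (y - (y`_0 / (N c.+1)`_0) *: N c.+1); split.
    - by apply: moments_vanishB => //; apply/moments_vanishZ/N_vanish.
    - rewrite size_polyDl // size_polyN sy (leq_ltn_trans (size_scale_leq _ _)) //.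
      by rewrite (leq_ltn_trans (N_size _)) // ltnS ltn_add2l.
    - by rewrite coefB coefZ divfK ?subrr // N_coef0.
    - by move=> k kc; exfalso; lia.
  rewrite negb_and -!leqNgt => ec; exists y; split=> //.
  - by apply: y0; rewrite !add0n.
  - by move=> k kc; apply: y0; rewrite !addSn.
elim/poly_ind: y1 H1 s1 z1 c1 => [|y2 a _]; first by rewrite size_poly0.
rewrite coefD coefMX coefC /= add0r => H1 s1 a0; rewrite a0 addr0 in H1 s1 *.
move=> c1; apply: (IH y2); first exact/moments_vanishMX.
  move: s1; have [->|y20] := eqVneq y2 0; first by rewrite mul0r size_poly0.
  by rewrite size_mulX // => -[->].
by move=> k kc; have := c1 k kc; rewrite coefMX.
Qed.

(** The descent replaces L^j q by its decimation, for the j < p that makes its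
    degree m + d j divisible by p; the degree e of the result is
    (m + d j) / p <= (m + d (p - 1)) / p < m. *)
Lemma descent m q : moments_vanish d B 0 q -> size q = m.+1 -> (d < m)%N ->
  exists e q', [/\ (e < m)%N, moments_vanish d B 0 q' & size q' = e.+1 /\ (0 < e)%N].
Proof.
move=> Hq sq dm; have p_gt0 := prime_gt0 p_pr.
have [j jp] : exists2 j, (j < p)%N & (p %| m + d * j)%N.
  pose x : 'F_p := - m%:R / d%:R.
  exists (x : nat); first by rewrite -[X in (_ < X)%N](Fp_cast p_pr) ltn_ord.
  have pF : p \in [pchar 'F_p] by rewrite pchar_Fp.
  have d0 : d%:R != 0 :> 'F_p by rewrite -(dvdn_pcharf pF).
  by rewrite (dvdn_pcharf pF) natrD natrM natr_Zp /x mulrC divfK // subrr.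
move=> /dvdnP[e e_def].
have e_gt0 : (0 < e)%N by lia.
have em : (e < m)%N by nia.
(* The factor X^(d (p - j)) turns L^j q = B^j q / z^(d j) into r / z^(d p), whose
   decimation is (decimate r) / z^d. *)
pose r : {poly 'F_p} := B ^+ j * q * 'X^(d * (p - j)).
have B0 : B != 0 by rewrite -size_poly_eq0 sizeB.
have q0 : q != 0 by rewrite -size_poly_eq0 sq.
have sBq : size (B ^+ j * q) = ((d + d) * j + m).+1.
  rewrite size_mul ?expf_neq0 // sq; have := size_exp B j.
  by rewrite sizeB /= => sj; rewrite -(prednK (n := size (B ^+ j))) ?sj ?addSn ?addnS //
     lt0n size_poly_eq0 expf_neq0.
have Bq0 : B ^+ j * q != 0 by rewrite mulf_neq0 ?expf_neq0.
have sr : size r = (p * (d + e)).+1.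
  by rewrite size_mulXn // sBq; nia.
have [] := @clear_poles d e (decimate r).
- (* The moment of order i of the decimation is that of order i p + j of q. *)
  move=> i; rewrite -decimateM -?exp_prime_comp_polyXn // coef_decimate //.
  rewrite mulrA coefMXn; have -> : (p * (d * i + d) < d * (p - j))%N = false by nia.
  rewrite -exprM mulrA -exprD.
  have -> : (p * (d * i + d) - d * (p - j) = d * (i * p + j) + 0)%N by nia.
  exact: Hq.
- apply/eqP; rewrite eqn_leq; apply/andP; split.
    apply/leq_sizeP => k kde; rewrite coef_decimate // nth_default // sr.
    by rewrite ltn_pmul2l.
  rewrite ltnNge; apply/negP => /leq_sizeP /(_ _ (leqnn _)).
  rewrite coef_decimate //.
  have := lead_coef_eq0 r; rewrite -size_poly_eq0 sr /lead_coef sr /= => lr rE.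
  by move: lr; rewrite rE eqxx.
- move=> k kde; rewrite coef_decimate // coefMXn; case: ltnP => // kd.
  have -> : (p * k - d * (p - j) = 0)%N by nia.
  by rewrite -horner_coef0 hornerM !horner_coef0 (moments_vanish_coef0 Hq) mulr0.
by move=> q' Hq' sq'; exists e, q'.
Qed.

Lemma moments_vanish_eq0 :
  (forall q, moments_vanish d B 0 q -> (size q <= d.+1)%N -> q = 0) ->
  forall q, moments_vanish d B 0 q -> q = 0.
Proof.
move=> base q; have [m] := ubnP (size q); elim: m q => // m IH q sq Hq.
have [/base->//|dq] := leqP (size q) d.+1.
have [||e [q' [em Hq' [sq' e0]]]] := descent (m := (size q).-1) Hq.
- by rewrite prednK // (leq_trans _ dq).
- by rewrite -ltnS prednK // (leq_trans _ dq).
have := IH q' _ Hq'; rewrite sq' => q'0.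
have : q' = 0 by apply: q'0; lia.
by move=> z; move: sq'; rewrite z size_poly0.
Qed.
End Descent.

(** * The family over Z[phi] and its reduction modulo 11 *)

Section GoldenFamily.
Variables (A : comNzRingType) (f : A).

(** At the golden ratio, where sqrt5 = 2 f - 1, the numerator of L divided by its
    leading coefficient; the roots a = f - 2 and b = 5 - 3 f are integral, unlike this
    coefficient. The next two definitions give z^k Qk and z^k (z Qk'). *)
Definition golden_num : {poly A} :=
  ('X - 1) ^+ 6 * ('X - (f - 2)%:P) ^+ 3 * ('X - (5 - 3 * f)%:P).

Definition golden_Q (k : nat) : {poly A} :=
  match k with
  | 1 => 'X^2 + 1
  | 2 => - (5 + 8 * f) *: 'X^4 + (12 + 16 * f) *: 'X^3 + 1
  | 3 => (13 + 21 * f) *: 'X^6 - (54 + 87 * f) *: 'X^5 + (72 + 111 * f) *: 'X^4 + 1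
  | 4 => - (5 + 8 * f) *: 'X^8 + (72 + 116 * f) *: 'X^7
           - (348 + 564 * f) *: 'X^6 + (504 + 812 * f) *: 'X^5 + 1
  | _ => 1
  end.

Definition golden_dQ (k : nat) : {poly A} :=
  (golden_Q k)^`() * 'X - golden_Q k *+ k.

Lemma golden_Q_coef0 k : (golden_Q k)`_0 = 1.
Proof.
by case: k => [|[|[|[|[|k]]]]]; rewrite /golden_Q !coefE /= ?mulr0 ?oppr0 ?add0r.
Qed.

Lemma golden_dQ_coef0 k : (golden_dQ k)`_0 = - k%:R.
Proof. by rewrite coefB coefMX coefMn golden_Q_coef0 sub0r. Qed.

Lemma size_golden_Q k : (size (golden_Q k) <= (k + k).+1)%N.
Proof.
apply/leq_sizeP; case: k => [|[|[|[|[|k]]]]] j kj; rewrite /golden_Q !coefE;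
  repeat case: eqP => [?|_]; try (subst; lia); rewrite ?mulr0 ?oppr0 ?addr0 //.
all: by rewrite subr0.
Qed.

Lemma size_golden_dQ k : (size (golden_dQ k) <= (k + k).+1)%N.
Proof.
apply/leq_sizeP => j kj; have Qj : (golden_Q k)`_j = 0.
  by rewrite nth_default // (leq_trans (size_golden_Q k)).
rewrite coefB coefMX coefMn Qj mul0rn subr0; case: j kj Qj => // j _.
by rewrite coef_deriv /= => ->; rewrite mul0rn.
Qed.
End GoldenFamily.

Lemma size_golden_num (F : fieldType) (f : F) : size (golden_num f) = 11%N.
Proof.
have n0 (c : F) n : ('X - c%:P) ^+ n != 0 by rewrite expf_neq0 // polyXsubC_eq0.
rewrite /golden_num -polyC1 size_mul ?mulf_neq0 ?n0 ?polyXsubC_eq0 //.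
by rewrite size_mul ?n0 // !size_exp_XsubC size_XsubC.
Qed.

(** The invertibility modulo 11 of the matrix of coefficients of z^-1, ..., z^-5 in
    L, ..., L^5: each unknown is exhibited as a combination of the equations, up to
    multiples of 11. *)
Lemma invertible_mod11 (A : comNzRingType) (a1 a2 a3 a4 a5 : A) : 11%:R = 0 :> A ->
  0 = 1 * a1 + 10 * a2 + 5 * a3 + 5 * a4 + 10 * a5 ->
  0 = 10 * a1 + 10 * a2 + 6 * a3 + 3 * a4 + 10 * a5 ->
  0 = 8 * a1 + 6 * a2 + 3 * a3 + 5 * a4 + 0 * a5 ->
  0 = 0 * a1 + 5 * a2 + 10 * a3 + 0 * a4 + 9 * a5 ->
  0 = 2 * a1 + 8 * a2 + 10 * a3 + 2 * a4 + 1 * a5 ->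
  [/\ a1 = 0, a2 = 0, a3 = 0, a4 = 0 & a5 = 0].
Proof.
move=> h11 e1 e2 e3 e4 e5; split.
- transitivity (9 * (1 * a1 + 10 * a2 + 5 * a3 + 5 * a4 + 10 * a5)
    + 1 * (10 * a1 + 10 * a2 + 6 * a3 + 3 * a4 + 10 * a5)
    + 10 * (8 * a1 + 6 * a2 + 3 * a3 + 5 * a4 + 0 * a5)
    + 9 * (0 * a1 + 5 * a2 + 10 * a3 + 0 * a4 + 9 * a5)
    + 6 * (2 * a1 + 8 * a2 + 10 * a3 + 2 * a4 + 1 * a5)
    - 11%:R * (10 * a1 + 23 * a2 + 21 * a3 + 10 * a4 + 17 * a5)).
    by ring.
  by rewrite -e1 -e2 -e3 -e4 -e5 h11 !(mulr0, mul0r, addr0, oppr0).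
- transitivity (7 * (1 * a1 + 10 * a2 + 5 * a3 + 5 * a4 + 10 * a5)
    + 10 * (10 * a1 + 10 * a2 + 6 * a3 + 3 * a4 + 10 * a5)
    + 8 * (8 * a1 + 6 * a2 + 3 * a3 + 5 * a4 + 0 * a5)
    + 1 * (0 * a1 + 5 * a2 + 10 * a3 + 0 * a4 + 9 * a5)
    + 8 * (2 * a1 + 8 * a2 + 10 * a3 + 2 * a4 + 1 * a5)
    - 11%:R * (17 * a1 + 26 * a2 + 19 * a3 + 11 * a4 + 17 * a5)).
    by ring.
  by rewrite -e1 -e2 -e3 -e4 -e5 h11 !(mulr0, mul0r, addr0, oppr0).
- transitivity (6 * (1 * a1 + 10 * a2 + 5 * a3 + 5 * a4 + 10 * a5)
    + 10 * (10 * a1 + 10 * a2 + 6 * a3 + 3 * a4 + 10 * a5)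
    + 3 * (8 * a1 + 6 * a2 + 3 * a3 + 5 * a4 + 0 * a5)
    + 9 * (0 * a1 + 5 * a2 + 10 * a3 + 0 * a4 + 9 * a5)
    + 1 * (2 * a1 + 8 * a2 + 10 * a3 + 2 * a4 + 1 * a5)
    - 11%:R * (12 * a1 + 21 * a2 + 18 * a3 + 7 * a4 + 22 * a5)).
    by ring.
  by rewrite -e1 -e2 -e3 -e4 -e5 h11 !(mulr0, mul0r, addr0, oppr0).
- transitivity (0 * (1 * a1 + 10 * a2 + 5 * a3 + 5 * a4 + 10 * a5)
    + 9 * (10 * a1 + 10 * a2 + 6 * a3 + 3 * a4 + 10 * a5)
    + 8 * (8 * a1 + 6 * a2 + 3 * a3 + 5 * a4 + 0 * a5)
    + 1 * (0 * a1 + 5 * a2 + 10 * a3 + 0 * a4 + 9 * a5)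
    + 0 * (2 * a1 + 8 * a2 + 10 * a3 + 2 * a4 + 1 * a5)
    - 11%:R * (14 * a1 + 13 * a2 + 8 * a3 + 6 * a4 + 9 * a5)).
    by ring.
  by rewrite -e1 -e2 -e3 -e4 -e5 h11 !(mulr0, mul0r, addr0, oppr0).
- transitivity (9 * (1 * a1 + 10 * a2 + 5 * a3 + 5 * a4 + 10 * a5)
    + 9 * (10 * a1 + 10 * a2 + 6 * a3 + 3 * a4 + 10 * a5)
    + 2 * (8 * a1 + 6 * a2 + 3 * a3 + 5 * a4 + 0 * a5)
    + 3 * (0 * a1 + 5 * a2 + 10 * a3 + 0 * a4 + 9 * a5)
    + 3 * (2 * a1 + 8 * a2 + 10 * a3 + 2 * a4 + 1 * a5)
    - 11%:R * (11 * a1 + 21 * a2 + 15 * a3 + 8 * a4 + 19 * a5)).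
    by ring.
  by rewrite -e1 -e2 -e3 -e4 -e5 h11 !(mulr0, mul0r, addr0, oppr0).
Qed.

Section Mod11.
Local Notation F := 'F_11.

Let F11_0 : 11%:R = 0 :> F. Proof. exact/eqP. Qed.

Let F11_mod n : (n %% 11)%:R = n%:R :> F.
Proof. by rewrite [in RHS](divn_eq n 11) natrD natrM F11_0 mulr0 add0r. Qed.

(* Products in F_11[X] are computed on lists of integers in [0, 11). *)
Fixpoint coef_add (u v : seq nat) : seq nat :=
  match u, v with
  | [::], _ => v
  | _, [::] => u
  | a :: u', b :: v' => ((a + b) %% 11)%N :: coef_add u' v'
  end.

Fixpoint coef_mul (u v : seq nat) : seq nat :=
  if u is a :: u' then
    coef_add [seq ((a * b) %% 11)%N | b <- v] (0%N :: coef_mul u' v)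
  else [::].

Definition poly11 (u : seq nat) : {poly F} := Poly [seq n%:R | n <- u].

Lemma poly11_cons a u : poly11 (a :: u) = poly11 u * 'X + (a%:R)%:P.
Proof. exact: cons_poly_def. Qed.

Lemma poly11_nil : poly11 [::] = 0.
Proof. by []. Qed.

Lemma poly11D u v : poly11 (coef_add u v) = poly11 u + poly11 v.
Proof.
elim: u v => [|a u IH] v; first by rewrite poly11_nil add0r.
case: v => [|b v]; first by rewrite poly11_nil addr0.
by rewrite [coef_add _ _]/= !poly11_cons IH F11_mod natrD polyCD; ring.
Qed.

Lemma poly11M u v : poly11 (coef_mul u v) = poly11 u * poly11 v.
Proof.
have scale a : poly11 [seq ((a * b) %% 11)%N | b <- v] = a%:R *: poly11 v.
  elim: v => [|b v IH]; first by rewrite poly11_nil scaler0.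
  by rewrite [map _ _]/= !poly11_cons IH F11_mod natrM polyCM -!mul_polyC; ring.
elim: u => [|a u IH]; first by rewrite poly11_nil mul0r.
by rewrite [coef_mul _ _]/= poly11D scale !poly11_cons IH -mul_polyC; ring.
Qed.

Lemma coef_poly11 u k : (poly11 u)`_k = (nth 0%N u k)%:R.
Proof.
rewrite coef_Poly; have [ku|uk] := ltnP k (size u); first by rewrite (nth_map 0%N).
by rewrite !nth_default // size_map.
Qed.

(** The coefficients of [golden_num 4], whose linear factors are X - 1, X - 2 and
    X + 7 modulo 11. *)
Definition golden11 : seq nat :=
  let m := coef_mul in let l6 := [:: 10; 1]%N in let l3 := [:: 9; 1]%N in
  m (m (m l6 (m l6 (m l6 (m l6 (m l6 l6))))) (m l3 (m l3 l3))) [:: 7; 1]%N.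

Lemma golden11E : golden_num (4 : F) = poly11 golden11.
Proof.
have lin a (c : F) : a%:R = - c -> poly11 [:: a; 1]%N = 'X - c%:P.
  move=> e; rewrite !poly11_cons e poly11_nil mul0r add0r polyCN polyC1.
  by rewrite mul1r.
rewrite /golden11; cbv zeta.
rewrite !poly11M (lin 10%N 1) ?(lin 9%N (4 - 2)) ?(lin 7%N (5 - 3 * 4));
  by [rewrite /golden_num -polyC1; ring | apply/eqP].
Qed.

Lemma moments_vanish_base (q : {poly F}) :
  moments_vanish 5 (golden_num (4 : F)) 0 q -> (size q <= 6)%N -> q = 0.
Proof.
move=> Hq sq; have q0 := moments_vanish_coef0 Hq.
pose pow i := iter i (coef_mul golden11) [:: 1%N].
have powE i : golden_num (4 : F) ^+ i = poly11 (pow i).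
  elim: i => [|i IH]; first by rewrite !poly11_cons poly11_nil !mul0r add0r.
  by rewrite exprS IH golden11E -poly11M.
have mom i : (0 < i)%N -> 0 = \sum_(k < 5) (nth 0%N (pow i) (5 * i - k.+1))%:R * q`_k.+1.
  move=> i0; rewrite -[LHS](Hq i) addn0 coefMr powE.
  rewrite -(big_mkord xpredT (fun k => (poly11 (pow i))`_(5 * i - k) * q`_k)).
  rewrite (@big_cat_nat _ _ _ 6) //=; last by rewrite ltnS; lia.
  rewrite [X in _ + X]big_nat_cond [X in _ + X]big1 ?addr0; last first.
    by move=> k /andP[/andP[k6 _] _]; rewrite [q`_k]nth_default ?mulr0 // (leq_trans sq).
  rewrite big_mkord big_ord_recl q0 mulr0 add0r.
  by apply: eq_bigr => k _; rewrite coef_poly11.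
have eqn i (b : seq nat) : (0 < i)%N ->
    [seq nth 0%N (pow i) (5 * i - k.+1) | k <- iota 0 5] = b ->
    0 = (nth 0%N b 0)%:R * q`_1 + (nth 0%N b 1)%:R * q`_2 + (nth 0%N b 2)%:R * q`_3
        + (nth 0%N b 3)%:R * q`_4 + (nth 0%N b 4)%:R * q`_5.
  by move=> i0 <-; apply: (etrans (mom i i0)); rewrite 4!big_ord_recl big_ord1 /= !addrA.
have e1 := eqn 1%N [:: 1; 10; 5; 5; 10]%N isT erefl.
have e2 := eqn 2%N [:: 10; 10; 6; 3; 10]%N isT erefl.
have e3 := eqn 3%N [:: 8; 6; 3; 5; 0]%N isT erefl.
have e4 := eqn 4%N [:: 0; 5; 10; 0; 9]%N isT erefl.
have e5 := eqn 5%N [:: 2; 8; 10; 2; 1]%N isT erefl.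
have [a1 a2 a3 a4 a5] := invertible_mod11 F11_0 e1 e2 e3 e4 e5.
apply/polyP => k; rewrite coef0.
by case: k => [|[|[|[|[|[|k]]]]]] //; rewrite nth_default // (leq_trans sq).
Qed.

(** The class of 4 is a golden ratio in the field with 11 elements, as
    4^2 = 16 = 4 + 1. *)
Lemma moments_vanish_mod11 :
  (forall k, (0 < k < 5)%N ->
     moments_vanish 5 (golden_num (4 : F)) k (golden_dQ (4 : F) k)) ->
  forall q, moments_vanish 5 (golden_num (4 : F)) 0 q -> q = 0.
Proof.
move=> dQ_vanish; apply: (@moments_vanish_eq0 11 isT 5 _ (golden_dQ 4)) => //.
- exact: size_golden_num.
- move=> k /andP[k0 k5]; rewrite golden_dQ_coef0 oppr_eq0.
  by case: k k0 k5 => [|[|[|[|[|k]]]]].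
- by move=> k _; exact: size_golden_dQ.
- exact: moments_vanish_base.
Qed.
End Mod11.

(** * Transfer from F_11 to the complex numbers *)

Section Specialization.
Variables (A : comNzRingType) (E : fieldType) (k : finFieldType).
Variables (toE : {rmorphism A -> E}) (tok : {rmorphism A -> k}).
Hypothesis specialize : forall a, toE a = 0 -> tok a = 0.
Variables (d : nat) (B : {poly A}).

Let mom i j := (B ^+ i * 'X^j)`_(d * i).

Let coef_mom (F : comNzRingType) (h : {rmorphism A -> F}) (q : {poly F}) m i :
  (size q <= m)%N ->
  (map_poly h B ^+ i * q)`_(d * i + 0) = \sum_(j < m) h (mom i j) * q`_j.
Proof.
move=> qm; have {1}-> : q = \sum_(j < m) q`_j *: 'X^j.
  rewrite -[LHS]coefK poly_def (big_ord_widen _ (fun j => q`_j *: 'X^j) qm).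
  rewrite big_mkcond; apply: eq_bigr => j _; case: ltnP => // qj.
  by rewrite nth_default // scale0r.
rewrite mulr_sumr coef_sum; apply: eq_bigr => j _.
rewrite -scalerAr coefZ mulrC; congr (_ * _).
by rewrite /mom -(map_polyXn h) -rmorphXn -rmorphM coef_map addn0.
Qed.

(** Finitely many moments separate the finitely many polynomials over k of a given
    size, so they form a matrix of full rank; some maximal minor is then nonzero
    over k, hence over E. *)
Lemma moments_vanish_specialize :
  (forall q, moments_vanish d (map_poly tok B) 0 q -> q = 0) ->
  forall q, moments_vanish d (map_poly toE B) 0 q -> q = 0.
Proof.
move=> inj_k q Hq; pose m := size q.
have sep (v : 'rV[k]_m) : exists i : nat,
    v != 0 -> \sum_(j < m) tok (mom i j) * v 0 j != 0.
  have [->|v0] := eqVneq v 0; first by exists 0%N.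
  pose qv := \poly_(j < m) (if insub j is Some j' then v 0 j' else 0).
  have qvE (j : 'I_m) : qv`_j = v 0 j by rewrite coef_poly ltn_ord valK.
  apply: contrapT => /forallNP sum0.
  have qv0 : qv = 0.
    apply: inj_k => i; rewrite (coef_mom _ _ (size_poly _ _)).
    apply/eqP; apply: contraT => s0; case: (sum0 i) => _; apply: contraNneq s0 => s0.
    by apply/eqP; rewrite -[RHS]s0; apply: eq_bigr => j _; rewrite qvE.
  by case/eqP: v0; apply/rowP => j; rewrite -qvE qv0 coef0 mxE.
have [N HN] := choice sep; pose I := (\max_v N v).+1.
pose M : 'M[A]_(I, m) := \matrix_(i, j) mom i j.
have full : row_full (map_mx tok M).
  rewrite /row_full -mxrank_tr -/(row_free _) -kermx_eq0; apply/rowV0P => v.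
  move=> /sub_kermxP vM; apply/eqP; apply: contraT => v0.
  have NI : (N v < I)%N by rewrite ltnS (leq_bigmax v).
  have := HN v v0; have /rowP/(_ (Ordinal NI)) := vM; rewrite !mxE => vM0.
  case/negP; apply/eqP; rewrite -[RHS]vM0; apply: eq_bigr => j _.
  by rewrite !mxE mulrC.
have detk : tok (\det (rowsub (fullrankfun full) M)) != 0.
  rewrite -det_map_mx map_mxsub -unitfE -unitmxE; exact: fullrowsub_unit.
have detE : toE (\det (rowsub (fullrankfun full) M)) != 0.
  by apply: contraNneq detk => /specialize ->.
have unitE : map_mx toE (rowsub (fullrankfun full) M) \in unitmx.
  by rewrite unitmxE det_map_mx unitfE.
pose c : 'cV[E]_m := \col_j q`_j.
have Mc : map_mx toE (rowsub (fullrankfun full) M) *m c = 0.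
  apply/colP => i; rewrite !mxE; set i' := fullrankfun full i.
  rewrite -[RHS](Hq i') (coef_mom toE _ (leqnn _)); apply: eq_bigr => j _.
  by rewrite !mxE.
have c0 : c = 0 by rewrite -(mulKmx unitE c) Mc mulmx0.
apply/polyP => j; rewrite coef0; have [jm|mj] := ltnP j m; last by rewrite nth_default.
by have /colP/(_ (Ordinal jm)) := c0; rewrite !mxE.
Qed.
End Specialization.

Lemma map_golden_num (A E : comNzRingType) (h : {rmorphism A -> E}) f :
  map_poly h (golden_num f) = golden_num (h f).
Proof.
have hX c : map_poly h ('X - c%:P) = 'X - (h c)%:P by exact: map_polyXsubC.
rewrite /golden_num (rmorphM (map_poly h)) (rmorphM (map_poly h) (_ ^+ 6)).
rewrite !(rmorphXn (map_poly h)) -!polyC1 /= !hX rmorph1.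
by rewrite !rmorphB (rmorphM h) !rmorph_nat.
Qed.

Lemma map_golden_Q (A E : comNzRingType) (h : {rmorphism A -> E}) f k :
  map_poly h (golden_Q f k) = golden_Q (h f) k.
Proof.
have hZ c n : map_poly h (c *: 'X^n) = h c *: 'X^n by rewrite map_polyZ map_polyXn.
have hc a b : h (a%:R + b%:R * f) = a%:R + b%:R * h f.
  by rewrite rmorphD (rmorphM h) !rmorph_nat.
case: k => [|[|[|[|[|k]]]]]; rewrite /golden_Q ?rmorph1 //;
  rewrite !(rmorphD (map_poly h)) ?(rmorphN (map_poly h)) rmorph1 /=;
  by rewrite ?map_polyXn ?hZ ?(rmorphN h) ?hc.
Qed.

Lemma map_golden_dQ (A E : comNzRingType) (h : {rmorphism A -> E}) f k :
  map_poly h (golden_dQ f k) = golden_dQ (h f) k.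
Proof.
rewrite /golden_dQ rmorphB rmorphMn (rmorphM (map_poly h)) /= map_polyX.
by rewrite -deriv_map map_golden_Q.
Qed.

(** The exponent of 5 is even in x^2 and odd in 5 y^2 unless y = 0. *)
Lemma sqr_eq_5sqr (x y : int) : x ^+ 2 = 5 * y ^+ 2 -> y = 0.
Proof.
move=> e; have {e} e : (`|x| ^ 2 = 5 * `|y| ^ 2)%N.
  by rewrite -!abszX e abszM.
apply/eqP; rewrite -absz_eq0 -leqn0 leqNgt; apply/negP => y0.
have := congr1 (logn 5) e; rewrite lognM ?expn_gt0 ?y0 // !lognX => e5.
by have := congr1 odd e5; rewrite oddD !oddM.
Qed.

(** Both evaluations factor through Z[phi], since u + v f with u, v integers vanishes
    in characteristic zero only for u = v = 0. *)
Lemma golden_specialize (E : numFieldType) (k : fieldType) (f : E) (g : k) :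
  f ^+ 2 = f + 1 -> g ^+ 2 = g + 1 -> forall a : {poly int},
  (map_poly intr a).[f] = 0 -> (map_poly intr a).[g] = 0.
Proof.
move=> f2 g2 a.
have [u [v [-> ->]]] : exists u v : int,
    (map_poly intr a).[f] = u%:~R + v%:~R * f
    /\ (map_poly intr a).[g] = u%:~R + v%:~R * g.
  elim/poly_ind: a => [|a c [u [v [IHf IHg]]]].
    by exists 0, 0; rewrite !rmorph0 !horner0 !mul0r !addr0.
  exists (v + c), (u + v).
  rewrite !rmorphD !rmorphM /= !map_polyX !map_polyC !hornerMXaddC /= IHf IHg.
  by split; [ring : f2 | ring : g2].
move=> uv0; suff v0 : v = 0.
  by move: uv0; rewrite v0 !mul0r !addr0 => /eqP; rewrite intr_eq0 => /eqP ->.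
apply: (@sqr_eq_5sqr (2 * u + v)); apply/eqP; rewrite -(eqr_int E).
rewrite !(rmorphD, rmorphM, rmorphXn) /=; apply/eqP.
have -> : u%:~R = - (v%:~R * f) :> E by apply/eqP; rewrite -addr_eq0 uv0.
ring : f2.
Qed.

Lemma golden_moments_vanish (E : numFieldType) (f : E) : f ^+ 2 = f + 1 ->
  (forall k, (0 < k < 5)%N -> moments_vanish 5 (golden_num f) k (golden_dQ f k)) ->
  forall q, moments_vanish 5 (golden_num f) 0 q -> q = 0.
Proof.
move=> f2 dQ_vanish.
pose toE : {rmorphism {poly int} -> E} := horner_eval f \o map_poly intr.
pose tok : {rmorphism {poly int} -> 'F_11} := horner_eval 4 \o map_poly intr.
have g2 : 4 ^+ 2 = 4 + 1 :> 'F_11 by apply/eqP.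
have spec a : toE a = 0 -> tok a = 0 := golden_specialize f2 g2 (a := a).
have toEX : toE 'X = f by rewrite /toE /= map_polyX /horner_eval hornerX.
have tokX : tok 'X = 4 by rewrite /tok /= map_polyX /horner_eval hornerX.
have := moments_vanish_specialize (d := 5) (B := golden_num 'X) spec.
rewrite !map_golden_num toEX tokX; apply; apply: moments_vanish_mod11 => k k5 i.
rewrite -tokX -map_golden_num -map_golden_dQ -rmorphXn -rmorphM coef_map.
apply: spec; rewrite -coef_map rmorphM rmorphXn /= map_golden_num map_golden_dQ toEX.
exact: dQ_vanish k5 i.
Qed.

(** * Orthogonal Laurent polynomials *)

Lemma golden_num_coef0 (F : fieldType) (f : F) :
  f ^+ 2 = f + 1 -> (golden_num f)`_0 != 0.
Proof.
move=> f2; have f2_neq0 : f - 2 != 0.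
  apply/eqP => e; have : (f - 2) * (f + 1) = - 1 by ring : f2.
  by rewrite e mul0r => /esym/eqP; rewrite oppr_eq0 oner_eq0.
have f5_neq0 : 5 - 3 * f != 0.
  apply/eqP => e; have : (5 - 3 * f) * (3 * f + 2) = 1 by ring : f2.
  by rewrite e mul0r => /esym/eqP; rewrite oner_eq0.
rewrite -horner_coef0 /golden_num -polyC1.
rewrite (hornerM (_ * _)) (hornerM (_ ^+ 6)) !horner_exp !hornerXsubC !sub0r.
by rewrite !mulf_neq0 ?expf_neq0 ?oppr_eq0 ?oner_eq0.
Qed.

Lemma module_sum (K : comNzRingType) (a0 a1 a2 a3 a4 b0 b1 b2 b3 b4 q0 q1 q2 q3 q4 : K) :
  (a0 + b0) * q0 + (a1 + b1) * q1 + (a2 + b2) * q2 + (a3 + b3) * q3 + (a4 + b4) * q4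
  = (a0 * q0 + a1 * q1 + a2 * q2 + a3 * q3 + a4 * q4)
    + (b0 * q0 + b1 * q1 + b2 * q2 + b3 * q3 + b4 * q4).
Proof. by ring. Qed.

Section OrthogonalModule.
Variable R : realType.
Local Notation C := R[i].
Local Notation K := {fraction {poly C}}.
Local Notation "x %:F" := (tofrac x).
Local Notation golden := ((1 + sqrt5 R) / 2).
Local Notation B := (golden_num golden).
(* The numerator of z times the derivative of q / z^n, over the denominator z^n. *)
Local Notation zderiv q n := (q^`() * 'X - q *+ n).

Lemma golden_sqr : golden ^+ 2 = golden + 1.
Proof. by have r5 := sqrt5_sqr R; field : r5. Qed.

Lemma coefK_neq0 : Defs.coefK R != 0.
Proof.
have r5 := sqrt5_sqr R; rewrite /Defs.coefK mulf_neq0 ?invr_eq0 ?pnatr_eq0 //.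
apply/eqP => e; have : (11 + 5 * sqrt5 R) * (11 - 5 * sqrt5 R) = - 4 by ring : r5.
by rewrite e mul0r => /esym/eqP; rewrite oppr_eq0 pnatr_eq0.
Qed.

Lemma L_golden : L R = laurent (Defs.coefK R *: B) 5.
Proof.
have eA : zeroA R = golden - 2 by rewrite /zeroA; field.
have eB : zeroB R = 5 - 3 * golden by rewrite /zeroB; field.
by rewrite /L eA eB.
Qed.

Lemma Q_golden : [/\ Q0 R = laurent (golden_Q golden 0) 0, Q1 R = laurent (golden_Q golden 1) 1,
  Q2 R = laurent (golden_Q golden 2) 2, Q3 R = laurent (golden_Q golden 3) 3
  & Q4 R = laurent (golden_Q golden 4) 4].
Proof.
have c1 : 9 + 4 * sqrt5 R = 5 + 8 * golden by field.
have c2 : 20 + 8 * sqrt5 R = 12 + 16 * golden by field.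
have c3 : 47 / 2 + 21 / 2 * sqrt5 R = 13 + 21 * golden by field.
have c4 : 195 / 2 + 87 / 2 * sqrt5 R = 54 + 87 * golden by field.
have c5 : 255 / 2 + 111 / 2 * sqrt5 R = 72 + 111 * golden by field.
have c6 : 130 + 58 * sqrt5 R = 72 + 116 * golden by field.
have c7 : 630 + 282 * sqrt5 R = 348 + 564 * golden by field.
have c8 : 910 + 406 * sqrt5 R = 504 + 812 * golden by field.
split.
- by rewrite /laurent tofrac1 expr0 divr1.
- by [].
- by rewrite /Q2 c1 c2.
- by rewrite /Q3 c3 c4 c5.
- by rewrite /Q4 c1 c6 c7 c8.
Qed.

Lemma laurentM (q1 q2 : {poly C}) n1 n2 :
  laurent q1 n1 * laurent q2 n2 = laurent (q1 * q2) (n1 + n2).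
Proof. by rewrite /laurent mulf_div tofracM exprD. Qed.

Lemma laurentX (q : {poly C}) n i : laurent q n ^+ i = laurent (q ^+ i) (n * i).
Proof.
elim: i => [|i IH]; first by rewrite muln0 /laurent !expr0 tofrac1 divr1.
by rewrite exprS IH laurentM exprS mulnS.
Qed.

Lemma integralE q n i :
  circle_integral (fun z => ratval (L R) z ^+ i * ratval (ratderiv (laurent q n)) z)
  = (2 * pi)%:C%C * ('i%C * (Defs.coefK R ^+ i * (B ^+ i * zderiv q n)`_(5 * i + n))).
Proof.
rewrite -coefZ scalerAl -exprZn; apply: circle_integral_residue => z z0.
rewrite L_golden ratderiv_laurent !ratval_laurent // expr_div_n mulf_div hornerM horner_exp.
by rewrite -exprM -exprD addnS.
Qed.

Lemma orthogonalE q n :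
  (forall i, circle_integral (fun z => ratval (L R) z ^+ i
      * ratval (ratderiv (laurent q n)) z) = 0)
  <-> moments_vanish 5 B n (zderiv q n).
Proof.
have pi0 : (2 * pi)%:C%C != 0 :> C.
  by rewrite (fmorph_eq0 (@real_complex R)) mulf_neq0 ?pnatr_eq0 // gt_eqF ?pi_gt0.
have i0 : 'i%C != 0 :> C by exact: neq0Ci.
split=> H i; last by rewrite integralE H !mulr0.
have /eqP := H i; rewrite integralE !mulf_eq0 (negbTE pi0) (negbTE i0) /=.
by rewrite expf_eq0 (negbTE coefK_neq0) andbF /= => /eqP.
Qed.

Lemma trace_orthogonal q n g :
  laurent q n = umbral (@ratconst C)
    (powersum (pair_sum ('X : {poly C})%:F)
       (pair_prod ('X : {poly C})%:F (ratconst (sqrt5 R)))) g ->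
  moments_vanish 5 B n (zderiv q n).
Proof.
move=> e i; have [G eG] := exact_trace i g.
move: eG; rewrite -e L_golden laurentX ratderiv_laurent laurentM addnS => eG.
have := residue_ratderiv (is_laurent_trace G) eG.
rewrite exprZn -scalerAl coefZ => /eqP; rewrite mulf_eq0 expf_eq0.
by rewrite (negbTE coefK_neq0) andbF /= => /eqP.
Qed.

Definition in_module (Q : K) := exists R0 R1 R2 R3 R4 : {poly C},
  Q = ratcomp R0 (L R) * Q0 R + ratcomp R1 (L R) * Q1 R
      + ratcomp R2 (L R) * Q2 R + ratcomp R3 (L R) * Q3 R
      + ratcomp R4 (L R) * Q4 R.

Lemma in_moduleD f g : in_module f -> in_module g -> in_module (f + g).
Proof.
move=> [a0 [a1 [a2 [a3 [a4 ->]]]]] [b0 [b1 [b2 [b3 [b4 ->]]]]].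
exists (a0 + b0), (a1 + b1), (a2 + b2), (a3 + b3), (a4 + b4).
have ratcompD P P' : ratcomp (P + P') (L R) = ratcomp P (L R) + ratcomp P' (L R).
  by rewrite /ratcomp rmorphD hornerD.
by rewrite !ratcompD; apply/esym/(@module_sum K).
Qed.

Lemma in_module_gen P k : (k < 5)%N ->
  in_module (ratcomp P (L R) * laurent (golden_Q golden k) k).
Proof.
have ratcomp0 : ratcomp 0 (L R) = 0 by rewrite /ratcomp rmorph0 horner0.
have [e0 e1 e2 e3 e4] := Q_golden; rewrite /in_module e0 e1 e2 e3 e4.
case: k => [|[|[|[|[|//]]]]] _.
- by exists P, 0, 0, 0, 0; rewrite ratcomp0 !mul0r !addr0.
- by exists 0, P, 0, 0, 0; rewrite ratcomp0 !mul0r !addr0 add0r.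
- by exists 0, 0, P, 0, 0; rewrite ratcomp0 !mul0r !addr0 add0r.
- by exists 0, 0, 0, P, 0; rewrite ratcomp0 !mul0r !addr0 add0r.
- by exists 0, 0, 0, 0, P; rewrite ratcomp0 !mul0r !addr0 add0r.
Qed.

Lemma module_orthogonal q n : in_module (laurent q n) ->
  moments_vanish 5 B n (zderiv q n).
Proof.
move=> [R0 [R1 [R2 [R3 [R4 e]]]]].
have [g eg] := module_trace R0 R1 R2 R3 R4.
by apply: (@trace_orthogonal _ _ g); rewrite e eg.
Qed.

Lemma polynomial_orthogonal_eq0 (q : {poly C}) : moments_vanish 5 B 0 q -> q = 0.
Proof.
apply: golden_moments_vanish; first exact: golden_sqr.
move=> k /andP[_ k5]; apply: module_orthogonal.
have := in_module_gen 1 k5; rewrite /ratcomp rmorph1 hornerC mul1r.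
exact.
Qed.

(** The pole order n.+1 = 5a + k is that of L^a Qk, a multiple of which cancels the
    leading term at 0. When there is no pole left, z Q' is a polynomial with vanishing
    moments, so Q' = 0. *)
Lemma orthogonal_module n q : moments_vanish 5 B n (zderiv q n) ->
  in_module (laurent q n).
Proof.
elim: n q => [|n IH] q Hq.
  have /polynomial_orthogonal_eq0/eqP : moments_vanish 5 B 0 (q^`() * 'X).
    by move: Hq; rewrite mulr0n subr0.
  rewrite mulf_eq0 polyX_eq0 orbF => /eqP q'0.
  have -> : q = (q`_0)%:P.
    apply/polyP => [[|k]]; rewrite coefC //=; apply/eqP.
    have := congr1 (fun h : {poly C} => h`_k) q'0.
    by rewrite coef_deriv coef0 => /eqP; rewrite mulrn_eq0.
  have := in_module_gen (q`_0)%:P (isT : (0 < 5)%N).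
  rewrite /ratcomp map_polyC hornerC /= /laurent tofrac1 expr0 !divr1 mulr1.
  exact.
pose k := (n.+1 %% 5)%N; pose a := (n.+1 %/ 5)%N.
have k5 : (k < 5)%N by rewrite ltn_mod.
have nE : (5 * a + k = n.+1)%N by rewrite mulnC -divn_eq.
pose e := (Defs.coefK R *: B) ^+ a * golden_Q golden k.
have eE c : ratcomp (c *: 'X^a) (L R) * laurent (golden_Q golden k) k
    = ratconst c * laurent e n.+1.
  rewrite /ratcomp map_polyZ map_polyXn hornerZ hornerXn.
  by rewrite -mulrA L_golden laurentX laurentM nE.
have e0 : e`_0 != 0.
  rewrite -horner_coef0 hornerM horner_exp hornerZ !horner_coef0 golden_Q_coef0 mulr1.
  by rewrite expf_neq0 // mulf_neq0 ?coefK_neq0 ?golden_num_coef0 ?golden_sqr.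
pose c := q`_0 / e`_0.
have [y yE] : exists y, q - c *: e = y * 'X.
  have : (q - c *: e)`_0 = 0 by rewrite coefB coefZ divfK // subrr.
  elim/poly_ind: (q - c *: e) => [|y b _]; first by move=> _; exists 0; rewrite mul0r.
  by rewrite coefD coefMX coefC add0r => ->; exists y; rewrite addr0.
have ce : in_module (laurent (c *: e) n.+1).
  have := in_module_gen (c *: 'X^a) k5; rewrite eE /laurent mulrA -tofracM mul_polyC.
  exact.
have -> : laurent q n.+1 = laurent y n + laurent (c *: e) n.+1.
  rewrite -[q in LHS](subrK (c *: e)) yE /laurent tofracD mulrDl tofracM exprSr.
  by rewrite -mulf_div divff ?mulr1 // tofrac_eq0 polyX_eq0.
apply: (in_moduleD _ ce); apply: IH; apply/moments_vanishMX.
have -> : zderiv y n * 'X = zderiv q n.+1 - zderiv (c *: e) n.+1.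
  have -> : q = y * 'X + c *: e by rewrite -yE subrK.
  rewrite derivD derivM derivX mulr1 mulrSr mulrnDl; ring.
apply: moments_vanishB Hq _; exact: module_orthogonal ce.
Qed.
End OrthogonalModule.

Theorem theorem1p1 (R : realType) (Q : {fraction {poly R[i]}})
    (hQ : is_laurent Q) :
  (forall i : nat,
     circle_integral (fun z => ratval (L R) z ^+ i * ratval (ratderiv Q) z) = 0)
  <->
  (exists R0 R1 R2 R3 R4 : {poly R[i]},
     Q = ratcomp R0 (L R) * Q0 R + ratcomp R1 (L R) * Q1 R
       + ratcomp R2 (L R) * Q2 R + ratcomp R3 (L R) * Q3 R
       + ratcomp R4 (L R) * Q4 R).
Proof.
case: hQ => [q [n ->]]; split=> [/orthogonalE|] H; first exact: orthogonal_module.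
by apply/orthogonalE/module_orthogonal.
Qed.
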